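(* Let $Sig$ be the set of isomorphism classes of derivable signatures of the type theory $TT_{Sig}$ described in the context, and let $FIC$ be the set of isomorphism classes of finite inverse categories whose objects are sort names and whose non-identity morphisms are variables. Then the assignments $R$ (signatures to finite inverse categories) and $S$ (finite inverse categories to signatures) described in the context induce well-defined maps $R\colon Sig\to FIC$ and $S\colon FIC\to Sig$, and these maps are mutually inverse. In particular $Sig$ and $FIC$ are in bijection.
   Context: Work in an extensional set theory. Fix disjoint countably infinite sets $Var$ (variables) and $SN$ (sort names), with a way of producing fresh elements not in any given finite subset. **Syntax of $TT_{Sig}$.** - Signatures: $\Psi ::= \bullet \mid \Psi, A:\Gamma$ with $A\in SN$. - Contexts: $\Gamma ::= \bullet \mid \Gamma, x:X$ with $x\in Var$. - Substitutions: $\sigma ::= \epsilon \mid (\sigma, t)$. - Terms: $t ::= x$ with $x \in Var$. - Sorts: $X ::= A\,\sigma$ with $A\in SN$. **Notation.** $A\notin\Psi$ (resp. $x\notin\Gamma$) means $A$ (resp. $x$) has not already been bound in $\Psi$ (resp. $\Gamma$). $A \,\#\, \Gamma$ and $x\,\#\,X$ mean freshness. $(A:\Delta)\in\Psi$ and $(x:X)\in\Gamma$ denote list membership. **Rules.** - (sig_empty) $\bullet\vdash$. - (sig_ext) from $\Psi\vdash$, $\Psi;\Gamma\vdash$ and $A\notin\Psi$, infer $\Psi, A:\Gamma\vdash$. - (ctx_empty) $\Psi;\bullet\vdash$. - (ctx_ext) from $\Psi;\Gamma\vdash$, $\Psi;\Gamma\vdash X$ and $x\notin\Gamma$, infer $\Psi;\Gamma,x:X\vdash$.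 - (sub_empty) $\Psi\vdash\epsilon:\Gamma\Rightarrow\bullet$. - (sub_ext) from $\Psi\vdash\sigma:\Gamma\Rightarrow\Delta$ and $\Psi;\Gamma\vdash z:\sigma(X)$, infer $\Psi\vdash(\sigma,z):\Gamma\Rightarrow\Delta,x:X$. - (type_var) from $(x:X)\in\Gamma$ and $\Psi;\Gamma\vdash$, infer $\Psi;\Gamma\vdash x:X$. - (type_sort) from $(A:\Delta)\in\Psi$ and $\Psi\vdash\sigma:\Gamma\Rightarrow\Delta$, infer $\Psi;\Gamma\vdash A\,\sigma$. - Congruence of contexts $\equiv$ is the equivalence relation generated by $\Gamma,x:X,y:Y,\Delta\equiv\Gamma,y:Y,x:X,\Delta$ whenever $x\,\#\,Y$ and $y\,\#\,X$. - Congruence of signatures is the equivalence relation generated by $\Psi,A:\Gamma,B:\Delta,\Phi\equiv\Psi,B:\Delta,A:\Gamma,\Phi$ whenever $A\,\#\,\Delta$ and $B\,\#\,\Gamma$. **Auxiliary definitions.** - $|\bullet|=\varnothing$ and $|\Gamma,x:X|=|\Gamma|\amalg\{x\}$. - For $Y\in SN$, $|\bullet|_Y=\varnothing$, and $|\Gamma,y:B\tau|_Y$ equals $|\Gamma|_Y\amalg\{y\}$ if $B=Y$ and $|\Gamma|_Y$ otherwise. - For a well-formed $\sigma:\Gamma\Rightarrow\Delta$, define $[\![\sigma]\!]:|\Delta|\to|\Gamma|$ by: $[\![\epsilon]\!]$ is the empty function, and $[\![\sigma,z]\!]$ on $|\Delta,x:X|$ sends $y\in|\Delta|$ to $[\![\sigma]\!](y)$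 and sends $x$ to $z$. - For $\sigma:\Gamma\Rightarrow\Delta$ and $\tau:\Delta\Rightarrow\Sigma$, define the composite $\sigma\cdot\tau$ by $\sigma\cdot\epsilon=\epsilon$ and $\sigma\cdot(\tau,z)=(\sigma\cdot\tau,[\![\sigma]\!](z))$. - The action on sorts is $\sigma(A\,\tau)=A\,(\sigma\cdot\tau)$. Two derivable signatures are isomorphic if they are congruent or $\alpha$-equivalent. $Sig$ is the set of isomorphism classes of $\Psi$ with $\Psi\vdash$ derivable. **Finite inverse categories.** A finite inverse category is a category with finitely many morphisms, no non-identity endomorphisms, and which is skeletal. $FIC$ denotes the set of isomorphism classes of finite inverse categories $\mathcal L$ with $\mathrm{ob}(\mathcal L)\subset SN$, non-identity morphisms forming a subset of $Var$, and identity morphisms written $1_K$. **The assignment $R$.** Defined by induction on derivations of signatures. - $R(\bullet)$ is the empty category. - $R(\Psi,K:\Gamma)$ has objects $\mathrm{ob}(R(\Psi))\amalg\{K\}$. - Its hom-sets are: $\hom(X,Y)=\hom_{R(\Psi)}(X,Y)$ for $X,Y\ne K$; $\hom(K,K)=\{1_K\}$; $\hom(X,K)=\varnothing$ for $X\neq K$; and $\hom(K,Y)=|\Gamma|_Y$ for $Y\ne K$. - Composition among old objects is that of $R(\Psi)$, and identities act as identities. - For $f\in|\Gamma|_Y$, with $(f: Y\,\sigma)\in\Gamma$ where $(Y:\Delta)\in\Psi$ and $\sigma:\Gamma\Rightarrow\Delta$, and for a non-identity $g:Y\to Z$ (so $g$ is a variable of $\Delta$), set $g\circ f=[\![\sigma]\!](g)$.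 **The assignment $S$.** Let $\mathcal L$ be such a finite inverse category. - Choose a linear ordering $K_1,\dots,K_n$ of its objects such that whenever there is a non-identity morphism $K'\to K$, $K$ comes before $K'$. - For each object $K$, let $\downarrow K$ denote the set of non-identity morphisms with domain $K$. Choose a linear ordering of $\downarrow K$ such that whenever $g\circ f\in\downarrow K$ with $g$ non-identity, $g\circ f$ precedes $f$. - For $f\in\downarrow K$, write $K_f$ for the codomain of $f$. - If $f_1,\dots,f_n$ is the ordered list of $\downarrow K$, and for each $i$, $p_{i1},\dots,p_{im_i}$ is the ordered list of $\downarrow K_{f_i}$, define the context $T_K=(f_1:K_{f_1}(p_{11}\circ f_1,\dots,p_{1m_1}\circ f_1),\dots,f_n:K_{f_n}(p_{n1}\circ f_n,\dots,p_{nm_n}\circ f_n))$, where $(v_1,\dots,v_k)$ denotes the substitution $(\dots(\epsilon,v_1),\dots,v_k)$. - Set $S(\mathcal L)=K_1:T_{K_1},\dots,K_n:T_{K_n}$, and $S(\varnothing)=\bullet$.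
   Formalization: Isomorphism of signatures also allows congruence swaps inside a context, permuting the arguments of later uses of that sort (else S depends on the chosen orderings), and R is applied to representatives whose bound variables are all distinct, which every class has. *)

(* Defs.v *)
From mathcomp Require Import all_boot.
From Stdlib Require Import Relations.Relation_Operators.

Set Implicit Arguments.
Unset Strict Implicit.
Unset Printing Implicit Defensive.

(* Var and SN: two countably infinite sets, disjoint (separate Rocq types,
   both represented by nat, which supplies fresh elements). *)
Notation Var := nat (only parsing).
Notation SN := nat (only parsing).

(* Lists are written in the natural (left-to-right) order:
   Gamma, x:X  is  rcons Gamma (x, X);  (sigma, t) is rcons sigma t. *)
Notation Subst := (seq nat) (only parsing).
Notation Sort := (nat * seq nat)%type (only parsing).          (* A sigma *)
Notation Ctx := (seq (nat * (nat * seq nat)))%type (only parsing).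
Notation Sig := (seq (nat * seq (nat * (nat * seq nat))))%type (only parsing).

Definition names (G : Ctx) : seq Var := map fst G.
Definition sig_names (P : Sig) : seq SN := map fst P.

(* [[sigma]] : |Delta| -> |Gamma|, defined by recursion on the last entry. *)
Fixpoint interp_rev (sr : seq Var) (Dr : Ctx) (y : Var) : Var :=
  match sr, Dr with
  | z :: s', (x, _) :: D' => if y == x then z else interp_rev s' D' y
  | _, _ => y
  end.
Definition interp (s : Subst) (D : Ctx) (y : Var) : Var :=
  interp_rev (rev s) (rev D) y.

Definition subst_comp (s : Subst) (D : Ctx) (t : Subst) : Subst :=
  map (interp s D) t.
Definition subst_sort (s : Subst) (D : Ctx) (X : Sort) : Sort :=
  (X.1, subst_comp s D X.2).

Inductive ctx_wf : Sig -> Ctx -> Prop :=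
| ctx_empty P : ctx_wf P [::]
| ctx_ext P G x X :
    ctx_wf P G -> sort_wf P G X -> x \notin names G ->
    ctx_wf P (rcons G (x, X))
with sub_wf : Sig -> Subst -> Ctx -> Ctx -> Prop :=
| sub_empty P G : sub_wf P [::] G [::]
| sub_ext P s G D z x X :
    sub_wf P s G D -> term_wf P G z (subst_sort s D X) ->
    sub_wf P (rcons s z) G (rcons D (x, X))
with term_wf : Sig -> Ctx -> Var -> Sort -> Prop :=
| type_var P G x X : (x, X) \in G -> ctx_wf P G -> term_wf P G x X
with sort_wf : Sig -> Ctx -> Sort -> Prop :=
| type_sort P G A D s : (A, D) \in P -> sub_wf P s G D -> sort_wf P G (A, s).

Inductive sig_wf : Sig -> Prop :=
| sig_empty : sig_wf [::]
| sig_ext P A G :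
    sig_wf P -> ctx_wf P G -> A \notin sig_names P -> sig_wf (rcons P (A, G)).

Definition sn_fresh (A : SN) (G : Ctx) : bool := all (fun e => e.2.1 != A) G.
Definition var_fresh (x : Var) (X : Sort) : bool := x \notin X.2.

Definition swap_at (i : nat) (s : Subst) : Subst :=
  if i.+1 < size s then take i s ++ nth 0 s i.+1 :: nth 0 s i :: drop i.+2 s
  else s.
Definition adjust_sort (A : SN) (i : nat) (X : Sort) : Sort :=
  if X.1 == A then (X.1, swap_at i X.2) else X.
Definition adjust_entry (A : SN) (i : nat) (e : SN * Ctx) : SN * Ctx :=
  (e.1, map (fun p => (p.1, adjust_sort A i p.2)) e.2).

Definition rename_entry (fo : SN -> SN) (g : Var -> Var) (e : SN * Ctx)
  : SN * Ctx :=
  (fo e.1, map (fun p => (g p.1, (fo p.2.1, map g p.2.2))) e.2).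

Definition alpha (P P' : Sig) : Prop :=
  exists fo : SN -> SN, injective fo /\ size P = size P' /\
    forall i, i < size P -> exists g : Var -> Var, injective g /\
      nth (0, [::]) P' i = rename_entry fo g (nth (0, [::]) P i).

Inductive sig_step : Sig -> Sig -> Prop :=
| step_swap (P1 P2 : Sig) A G B D :
    sn_fresh A D -> sn_fresh B G ->
    sig_step (P1 ++ (A, G) :: (B, D) :: P2) (P1 ++ (B, D) :: (A, G) :: P2)
| step_ctx (P1 P2 : Sig) A (G1 G2 : Ctx) x X y Y :
    var_fresh x Y -> var_fresh y X ->
    sig_step (P1 ++ (A, G1 ++ (x, X) :: (y, Y) :: G2) :: P2)
             (P1 ++ (A, G1 ++ (y, Y) :: (x, X) :: G2)
                 :: map (adjust_entry A (size G1)) P2)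
| step_alpha P P' : alpha P P' -> sig_step P P'.

Definition sig_iso : Sig -> Sig -> Prop := clos_refl_sym_trans _ sig_step.

Definition clean (P : Sig) : bool := uniq (flatten [seq names e.2 | e <- P]).

Inductive Mor := MId of SN | MArr of Var.

Record fcat := Cat {
  obs : seq SN;
  ars : seq Var;                (* non-identity morphisms *)
  dom : Var -> SN;
  cod : Var -> SN;
  comp : Var -> Var -> Mor      (* comp g f = g o f *)
}.

Definition compM (C : fcat) (g f : Mor) : Mor :=
  match g, f with
  | MId _, _ => f
  | _, MId _ => g
  | MArr g', MArr f' => comp C g' f'
  end.

Definition is_fic (C : fcat) : Prop :=
  uniq (obs C) /\ uniq (ars C) /\
  (forall f, f \in ars C -> dom C f \in obs C /\ cod C f \in obs C) /\
  (forall f g, f \in ars C -> g \in ars C -> cod C f = dom C g ->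
     match comp C g f with
     | MId K => K = dom C f /\ K = cod C g
     | MArr h => [/\ h \in ars C, dom C h = dom C f & cod C h = cod C g]
     end) /\
  (forall f g h, f \in ars C -> g \in ars C -> h \in ars C ->
     cod C f = dom C g -> cod C g = dom C h ->
     compM C (MArr h) (compM C (MArr g) (MArr f)) =
     compM C (compM C (MArr h) (MArr g)) (MArr f)) /\
  (forall f, f \in ars C -> dom C f <> cod C f) /\
  (forall f g, f \in ars C -> g \in ars C ->
     cod C f = dom C g -> cod C g = dom C f ->
     comp C g f = MId (dom C f) -> comp C f g = MId (dom C g) ->
     dom C f = cod C f).

Definition mapMor (fo : SN -> SN) (fa : Var -> Var) (m : Mor) : Mor :=
  match m with MId K => MId (fo K) | MArr f => MArr (fa f) end.

Definition cat_iso (C D : fcat) : Prop :=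
  exists (fo : SN -> SN) (fa : Var -> Var),
    {in obs C &, injective fo} /\ {in ars C &, injective fa} /\
    perm_eq (map fo (obs C)) (obs D) /\ perm_eq (map fa (ars C)) (ars D) /\
    (forall f, f \in ars C ->
       dom D (fa f) = fo (dom C f) /\ cod D (fa f) = fo (cod C f)) /\
    (forall f g, f \in ars C -> g \in ars C -> cod C f = dom C g ->
       comp D (fa g) (fa f) = mapMor fo fa (comp C g f)).

Definition ctx_lookup (G : Ctx) (x : Var) : Sort :=
  nth (0, [::]) (map snd G) (index x (names G)).
Definition sig_lookup (P : Sig) (A : SN) : Ctx :=
  nth [::] (map snd P) (index A (sig_names P)).

Definition empty_cat : fcat :=
  Cat [::] [::] (fun _ => 0) (fun _ => 0) (fun _ _ => MId 0).

Fixpoint R_rev (Pr : Sig) : fcat :=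
  match Pr with
  | [::] => empty_cat
  | (K, G) :: Pr' =>
      let C := R_rev Pr' in
      let P := rev Pr' in
      Cat (K :: obs C) (names G ++ ars C)
        (fun x => if x \in names G then K else dom C x)
        (fun x => if x \in names G then (ctx_lookup G x).1 else cod C x)
        (fun g f => if f \in names G then
                      let Ys := ctx_lookup G f in
                      MArr (interp Ys.2 (sig_lookup P Ys.1) g)
                    else comp C g f)
  end.
Definition R_raw (P : Sig) : fcat := R_rev (rev P).

(* The assignment S, depending on the chosen orderings:
   oo : the ordering K_1 ... K_n of the objects,
   ao K : the ordering of down(K). *)
Definition valid_ord (C : fcat) (oo : seq SN) (ao : SN -> seq Var) : Prop :=
  [/\ perm_eq oo (obs C),
      (forall f, f \in ars C -> index (cod C f) oo < index (dom C f) oo),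
      (forall K, K \in obs C -> perm_eq (ao K) [seq f <- ars C | dom C f == K]) &
      (forall K f g h, K \in obs C -> f \in ao K -> g \in ars C ->
         cod C f = dom C g -> comp C g f = MArr h ->
         index h (ao K) < index f (ao K))].

Definition mor_var (m : Mor) : Var := if m is MArr h then h else 0.

Definition T_ctx (C : fcat) (ao : SN -> seq Var) (K : SN) : Ctx :=
  [seq (f, (cod C f, [seq mor_var (comp C p f) | p <- ao (cod C f)]))
  | f <- ao K].

Definition S_raw (C : fcat) (oo : seq SN) (ao : SN -> seq Var) : Sig :=
  [seq (K, T_ctx C ao K) | K <- oo].

(* Main.v *)
From mathcomp Require Import all_boot.
From Stdlib Require Import Relations.Relation_Operators.
Require Import Defs.

Set Implicit Arguments.
Unset Strict Implicit.
Unset Printing Implicit Defensive.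

(** A derivable signature is the same thing as a finite inverse category
    together with a linear order of its objects and of the arrows out of each
    object: the argument list of [f] in the context of [K] is forced to be the
    list of composites of [f] with the arrows out of its codomain, and
    derivability is the category laws plus compatibility with the orders.
    A congruence step transposes two independent neighbours in one of the
    orders, and alpha-equivalence renames, so both leave the underlying
    category unchanged up to isomorphism.  Conversely, two orders compatible
    with the same category are linked by such transpositions. *)

(** Two mismatches shape the proof. A category names each arrow once, while contexts of different
    sorts may reuse variables; hence structures whose arrows are indexed by source and name, and a
    comparison with [R_raw] only for [clean] signatures, which every class contains. Alpha steps
    demand renamings injective on all of [nat], while an isomorphism is injective only on its finite
    carrier; hence [extend]. Argument lists are never stored but recomputed from the order of the
    arrows. Permuting the arrows out of A therefore permutes the arguments of A in all later
    contexts, which is exactly the adjustment built into [step_ctx]. Associativity is hidden in the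
    substitution rule: each entry must have the substituted sort, and reading its arguments off the
    context in two ways gives the law. Transpositions suffice because a dependent pair, of objects
    or of arrows, is ordered the same way by every compatible order. *)

Lemma index_map_in (T U : eqType) (f : T -> U) (s : seq T) (x : T) :
  {in s &, injective f} -> x \in s -> index (f x) (map f s) = index x s.
Proof.
elim: s => //= y s IH fI xs; rewrite (inj_in_eq fI) ?mem_head //.
case: eqVneq xs => // yx; rewrite inE eq_sym (negPf yx) => xs.
by rewrite IH // => a b aS bS; apply: fI; rewrite inE ?aS ?bS orbT.
Qed.

Definition inv_on (f : nat -> nat) (s : seq nat) (y : nat) : nat :=
  nth 0 s (index y (map f s)).

Lemma inv_onK (f : nat -> nat) (s : seq nat) :
  {in s &, injective f} -> {in s, cancel f (inv_on f s)}.
Proof.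
by move=> fI x xs; rewrite /inv_on index_map_in // nth_index.
Qed.

(** Points outside [s] are sent above every value taken on [s], so injectivity on [s] becomes global
    injectivity, as [alpha] demands. *)
Definition extend (f : nat -> nat) (s : seq nat) (x : nat) : nat :=
  if x \in s then f x else (\max_(y <- map f s) y).+1 + x.

Lemma extend_in (f : nat -> nat) (s : seq nat) : {in s, extend f s =1 f}.
Proof. by move=> x xs; rewrite /extend xs. Qed.

Lemma extend_inj (f : nat -> nat) (s : seq nat) :
  {in s &, injective f} -> injective (extend f s).
Proof.
move=> fI x y; rewrite /extend.
have ltM z t : z \in s -> f z < (\max_(y <- map f s) y).+1 + t.
  by move=> zs; rewrite ltn_addr // ltnS (leq_bigmax_seq (f z)) // map_f.
case: ifPn => xs; case: ifPn => ys; first exact: fI.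
- by move=> e; have := ltM x y xs; rewrite e ltnn.
- by move=> e; have := ltM y x ys; rewrite -e ltnn.
- exact: addnI.
Qed.

(** Choice over a finite range, proved by induction; it collects the renamings that [alpha] provides
    entry by entry into one function. *)
Lemma choose_below (T : Type) (n : nat) (Q : nat -> T -> Prop) (t0 : T) :
  (forall i, i < n -> exists t, Q i t) ->
  exists F, forall i, i < n -> Q i (F i).
Proof.
elim: n => [|n IHn] H; first by exists (fun=> t0).
have [i ltin|F HF] := IHn; first by apply: H; rewrite ltnS ltnW.
have [t Ht] := H n (ltnSn n).
exists (fun i => if i == n then t else F i) => i; rewrite ltnS leq_eqVlt.
by case: eqP => [->|_] //= /HF.
Qed.

(** * Prefixes of lists and adjacent transpositions *)

Lemma map_eq_cat (T U : Type) (f : T -> U) s t1 t2 :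
  map f s = t1 ++ t2 -> exists s1 s2, [/\ s = s1 ++ s2, map f s1 = t1 & map f s2 = t2].
Proof.
move=> e; exists (take (size t1) s), (drop (size t1) s).
by rewrite cat_take_drop map_take map_drop e take_size_cat // drop_size_cat.
Qed.

Lemma index_lt_prefix (T : eqType) (s t : seq T) x y :
  uniq (s ++ y :: t) ->
  (index x (s ++ y :: t) < index y (s ++ y :: t)) = (x \in s).
Proof.
rewrite cat_uniq => /and3P[_ /hasPn/(_ _ (mem_head _ _))/= yNs _].
rewrite !index_cat (negPf yNs) /= eqxx addn0.
by case: ifP => xs; rewrite ?index_mem // ltnNge leq_addr.
Qed.

Lemma mem_prefix (T : eqType) (s t : seq T) x y :
  uniq (s ++ y :: t) -> index x (s ++ y :: t) < index y (s ++ y :: t) -> x \in s.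
Proof.
by move=> u; rewrite index_lt_prefix.
Qed.

(** A transposition of neighbours reverses the relative order of no pair except the transposed one.
    Compatibility with an order thus survives unless [(a, b)] itself is a required inequality, which
    the freshness conditions exclude. *)
Lemma index_swap (T : eqType) (s t : seq T) a b x y :
  uniq (s ++ a :: b :: t) -> (x, y) <> (a, b) ->
  index x (s ++ a :: b :: t) < index y (s ++ a :: b :: t) ->
  index x (s ++ b :: a :: t) < index y (s ++ b :: a :: t).
Proof.
rewrite cat_uniq /= !inE !negb_or => /and4P[_ /and3P[aNs bNs _] /andP[ab _] _] nxy.
rewrite !index_cat; case: ifPn => xs; case: ifPn => ys //.
  by move=> _; rewrite (leq_trans (_ : _ < size s)) ?index_mem ?leq_addr.
  by move=> lt; have := leq_trans lt (index_size _ _); rewrite ltnNge leq_addr.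
rewrite !ltn_add2l /= ![b == _]eq_sym ![a == _]eq_sym.
have [xa|xa] := eqVneq x a; have [yb|yb] := eqVneq y b.
- by case: nxy; rewrite xa yb.
- by rewrite xa (negPf ab); case: (y == a).
- by rewrite yb [b == a]eq_sym (negPf ab); case: (x == b).
- by have [xb|xb] := eqVneq x b; have [ya|ya] := eqVneq y a.
Qed.

Lemma perm_swap (T : eqType) (s t : seq T) a b :
  perm_eq (s ++ a :: b :: t) (s ++ b :: a :: t).
Proof. by rewrite perm_cat2l (perm_catCA [:: a] [:: b] t). Qed.

Inductive swaps (T : eqType) (ind : T -> T -> Prop) (s : seq T) : seq T -> Prop :=
| swaps_refl : swaps ind s s
| swaps_step s1 a b s2 :
    swaps ind s (s1 ++ a :: b :: s2) -> ind a b ->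
    swaps ind s (s1 ++ b :: a :: s2).

Lemma swaps_trans (T : eqType) (ind : T -> T -> Prop) s t u :
  swaps ind s t -> swaps ind t u -> swaps ind s u.
Proof. by move=> st; elim=> // s1 a b s2 _ IH /(swaps_step IH). Qed.

Lemma swaps_rcons (T : eqType) (ind : T -> T -> Prop) s t x :
  swaps ind s t -> swaps ind (rcons s x) (rcons t x).
Proof.
elim=> [|s1 a b s2 _ IH iab]; first exact: swaps_refl.
by move: IH; rewrite !rcons_cat => IH; apply: swaps_step IH iab.
Qed.

Lemma swaps_to_end (T : eqType) (ind : T -> T -> Prop) s1 x s2 :
  (forall y, y \in s2 -> ind x y) ->
  swaps ind (s1 ++ x :: s2) (rcons (s1 ++ s2) x).
Proof.
elim: s2 s1 => [|y s2 IH] s1 H.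
  by rewrite cats0 cats1; apply: swaps_refl.
apply: swaps_trans (_ : swaps ind _ (rcons s1 y ++ x :: s2)) _.
  by rewrite cat_rcons; apply: swaps_step (swaps_refl _ _) (H _ (mem_head _ _)).
rewrite -[s1 ++ y :: s2]cat_rcons; apply: IH => z zs.
by apply: H; rewrite inE zs orbT.
Qed.

(* Move the last element of the target list to the end, then recurse. *)
Lemma swaps_perm (T : eqType) (ind : T -> T -> Prop) (s t : seq T) :
  uniq s -> perm_eq s t ->
  (forall x y, index x s < index y s -> index y t < index x t ->
     x \in s -> y \in s -> ind x y) ->
  swaps ind s t.
Proof.
elim/last_ind: t s => [|t x IH] s us pst H.
  by rewrite (perm_nilP pst); apply: swaps_refl.
have xs : x \in s by rewrite (perm_mem pst) mem_rcons mem_head.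
case/splitPr: xs us pst H => s1 s2 us pst H.
have ps : perm_eq (s1 ++ x :: s2) (rcons (s1 ++ s2) x).
  by rewrite perm_sym perm_rcons -cat1s perm_catCA.
have ut : uniq (rcons t x) by rewrite -(perm_uniq pst).
have ps' : perm_eq (s1 ++ s2) t.
  have: perm_eq (rcons (s1 ++ s2) x) (rcons t x) by rewrite -(permPl ps).
  by rewrite perm_rcons perm_sym perm_rcons perm_cons perm_sym.
have xNt : x \notin t by move: ut; rewrite rcons_uniq => /andP[].
have xN1 : x \notin s1 by move: xNt; rewrite -(perm_mem ps') mem_cat negb_or => /andP[].
have xN2 : x \notin s2 by move: xNt; rewrite -(perm_mem ps') mem_cat negb_or => /andP[].
have us' : uniq (s1 ++ s2).
  by rewrite (perm_uniq ps'); move: ut; rewrite rcons_uniq => /andP[].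
apply: swaps_trans (_ : swaps ind _ (rcons (s1 ++ s2) x)) _.
  apply: swaps_to_end => y y2; have yN1 : y \notin s1.
    move: us'; rewrite cat_uniq => /and3P[_ /hasPn h _]; exact: h.
  apply: H; rewrite ?mem_cat ?inE ?eqxx ?y2 ?orbT //.
    rewrite !index_cat (negPf xN1) (negPf yN1) ltn_add2l /= eqxx.
    by case: eqP => // xy; rewrite xy y2 in xN2.
  have yt : y \in t by rewrite -(perm_mem ps') mem_cat y2 orbT.
  by rewrite -cats1 !index_cat yt (negPf xNt) /= eqxx addn0 index_mem.
apply: swaps_rcons; apply: IH => // y z ltyz ltzy ys zs.
have nx w : w \in s1 ++ s2 -> w != x.
  by move=> ws; apply: contraNneq xNt => <-; rewrite -(perm_mem ps').
have yx := nx _ ys; have zx := nx _ zs.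
apply: H; last 2 first.
- by move: ys; rewrite !mem_cat inE orbCA => ->; rewrite orbT.
- by move: zs; rewrite !mem_cat inE orbCA => ->; rewrite orbT.
- move: ltyz; rewrite !index_cat /= ![x == _]eq_sym (negPf yx) (negPf zx).
  case: ifPn => y1; case: ifPn => z1 //.
    by rewrite ltn_addr // ?(leq_trans _ (leq_addr _ _)) ?index_mem.
    by move=> lt; have := leq_trans lt (index_size _ _); rewrite ltnNge leq_addr.
  by rewrite !ltn_add2l ltnS.
rewrite -cats1 !index_cat -!(perm_mem ps') ys zs //.
Qed.

(** * Signatures as ordered categories *)

(* An ordered presentation of a finite inverse category: [so] lists the
   objects, [sa K] the non-identity arrows out of [K], [sh K f] is the codomain
   of [f] and [sc K f y] the composite of [y] after [f].  Arrows out of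
   different objects may share their name, as variables of different contexts
   do. *)
Record str := Str {
  so : seq nat;
  sa : nat -> seq nat;
  sh : nat -> nat -> nat;
  sc : nat -> nat -> nat -> nat
}.

(** Since the arguments are computed by running through [sa S (sh S K f)], a change of [sa] at one
    object reorders the arguments at every arrow into that object. *)
Definition ent (S : str) (K f : nat) : nat * (nat * seq nat) :=
  (f, (sh S K f, [seq sc S K f y | y <- sa S (sh S K f)])).
Definition ctxt (S : str) (K : nat) := map (ent S K) (sa S K).
Definition sigma_on (S : str) (o : seq nat) := [seq (K, ctxt S K) | K <- o].
Definition sigma (S : str) := sigma_on S (so S).

(** Only non-identity arrows occur. [sc_sa], [sh_sc] and [sc_sc] are the category laws; [sh_lt] and
    [sc_lt] express compatibility with the two orders, and [sh_lt] also rules out endomorphisms. *)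
Record valid (S : str) : Prop := Valid {
  uniq_so : uniq (so S);
  uniq_sa : forall K, K \in so S -> uniq (sa S K);
  sh_so : forall K f, K \in so S -> f \in sa S K -> sh S K f \in so S;
  sh_lt : forall K f, K \in so S -> f \in sa S K ->
    index (sh S K f) (so S) < index K (so S);
  sc_sa : forall K f y, K \in so S -> f \in sa S K -> y \in sa S (sh S K f) ->
    sc S K f y \in sa S K;
  sc_lt : forall K f y, K \in so S -> f \in sa S K -> y \in sa S (sh S K f) ->
    index (sc S K f y) (sa S K) < index f (sa S K);
  sh_sc : forall K f y, K \in so S -> f \in sa S K -> y \in sa S (sh S K f) ->
    sh S K (sc S K f y) = sh S (sh S K f) y;
  sc_sc : forall K f y z, K \in so S -> f \in sa S K -> y \in sa S (sh S K f) ->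
    z \in sa S (sh S (sh S K f) y) ->
    sc S K (sc S K f y) z = sc S K f (sc S (sh S K f) y z)
}.

(** * Ordered categories give derivable signatures *)

Lemma sig_names_sigma_on S o : sig_names (sigma_on S o) = o.
Proof. by rewrite /sig_names /sigma_on -map_comp map_id_in. Qed.

Lemma names_map_ent S K a : names (map (ent S K) a) = a.
Proof. by rewrite /names -map_comp map_id_in. Qed.

Lemma names_ctxt S K : names (ctxt S K) = sa S K.
Proof. exact: names_map_ent. Qed.

Lemma mem_sigma_on S o A D :
  ((A, D) \in sigma_on S o) = (A \in o) && (D == ctxt S A).
Proof.
apply/mapP/andP => [[y ya [-> ->]]|[xa /eqP->]]; first by rewrite ya eqxx.
by exists A.
Qed.

Lemma sig_lookup_sigma_on S o A : A \in o -> sig_lookup (sigma_on S o) A = ctxt S A.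
Proof.
move=> Ao; rewrite /sig_lookup sig_names_sigma_on -map_comp.
by rewrite (nth_map 0) ?index_mem // nth_index.
Qed.

Lemma ctx_lookup_map_ent S K a f : f \in a ->
  ctx_lookup (map (ent S K) a) f = (ent S K f).2.
Proof.
move=> fa; rewrite /ctx_lookup names_map_ent -map_comp.
by rewrite (nth_map 0) ?index_mem // nth_index.
Qed.

Lemma interp_rcons s z D x (X : nat * seq nat) y :
  interp (rcons s z) (rcons D (x, X)) y = if y == x then z else interp s D y.
Proof. by rewrite /interp !rev_rcons. Qed.

Lemma interp_graph S K (F : nat -> nat) (a : seq nat) y :
  interp (map F a) (map (ent S K) a) y = if y \in a then F y else y.
Proof.
elim/last_ind: a => [|a x IH] //; rewrite !map_rcons interp_rcons IH mem_rcons inE.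
by case: eqP => // ->.
Qed.

(** By [sc_lt], all arguments of [f] are already in the part of the context built before [f]. *)
Lemma mem_arg_prefix S K f a b z : valid S -> K \in so S ->
  sa S K = a ++ f :: b -> z \in sa S (sh S K f) -> sc S K f z \in a.
Proof.
move=> vS Ko ea zs; have fa : f \in sa S K by rewrite ea mem_cat mem_head orbT.
have := sc_lt vS Ko fa zs; have := uniq_sa vS Ko.
by rewrite ea; apply: mem_prefix.
Qed.

Lemma sub_wf_sigma S P G K f (b : seq nat) b' : valid S -> K \in so S -> f \in sa S K ->
  sa S (sh S K f) = b ++ b' -> ctx_wf P G ->
  {in b, forall y, ent S K (sc S K f y) \in G} ->
  sub_wf P [seq sc S K f y | y <- b] G (map (ent S (sh S K f)) b).
Proof.
move=> vS Ko fa eb wG; elim/last_ind: b b' eb => [|b y IH] b' eb Hb.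
  exact: sub_empty.
move: eb; rewrite cat_rcons => eb; rewrite !map_rcons.
have ya : y \in sa S (sh S K f) by rewrite eb mem_cat mem_head orbT.
apply: sub_ext.
  by apply: IH eb _ => z zb; apply: Hb; rewrite mem_rcons inE zb orbT.
(* The sort demanded by [sub_ext] has to be the one recorded in [G]: [sh_sc] matches the heads and
   associativity [sc_sc] the arguments, once the substitution is evaluated on the prefix [b]. *)
apply: type_var wG; have := Hb y; rewrite mem_rcons mem_head /subst_sort /=.
rewrite /ent (sh_sc vS Ko fa ya) => /(_ isT); congr (_ \in G); do 2!congr pair.
rewrite /subst_comp -map_comp; apply/eq_in_map => z za /=.
rewrite interp_graph (mem_arg_prefix vS (sh_so vS Ko fa) eb za).
exact: sc_sc.
Qed.

Lemma ctx_wf_sigma S o o' K a a' : valid S -> so S = o ++ K :: o' ->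
  sa S K = a ++ a' -> ctx_wf (sigma_on S o) (map (ent S K) a).
Proof.
move=> vS eo; have Ko : K \in so S by rewrite eo mem_cat mem_head orbT.
elim/last_ind: a a' => [|a f IH] a'; first by move=> _; apply: ctx_empty.
rewrite cat_rcons => ea; have wa := IH _ ea; rewrite map_rcons.
have fa : f \in sa S K by rewrite ea mem_cat mem_head orbT.
have := uniq_sa vS Ko; rewrite ea cat_uniq => /and3P[_ /hasPn/(_ f (mem_head _ _)) fNa _].
apply: (ctx_ext wa); last by rewrite names_map_ent.
apply: (@type_sort _ _ _ (ctxt S (sh S K f))).
  rewrite mem_sigma_on eqxx andbT; have := sh_lt vS Ko fa; have := uniq_so vS.
  by rewrite eo; apply: mem_prefix.
apply: (sub_wf_sigma (b' := [::])) => //; first by rewrite cats0.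
by move=> y ya; rewrite mem_map; [apply: mem_arg_prefix ea ya|move=> ? ? []].
Qed.

Lemma sigma_wf S : valid S -> sig_wf (sigma S).
Proof.
move=> vS; rewrite /sigma.
suff H o o' : so S = o ++ o' -> sig_wf (sigma_on S o) by apply: (H _ [::]); rewrite cats0.
elim/last_ind: o o' => [|o K IH] o'; first by move=> _; apply: sig_empty.
rewrite cat_rcons => eo; rewrite /sigma_on map_rcons; apply: sig_ext (IH _ eo) _ _.
  by apply: (ctx_wf_sigma (a' := [::])) eo _; rewrite ?cats0.
rewrite sig_names_sigma_on; have := uniq_so vS.
by rewrite eo cat_uniq => /and3P[_ /hasPn/(_ K (mem_head _ _))].
Qed.

(** * Derivable signatures come from ordered categories *)

Lemma size_sub_wf P s G D : sub_wf P s G D -> size s = size D.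
Proof. by elim=> // *; rewrite !size_rcons; congr S. Qed.

Lemma sub_wf_rcons P s G D x X : sub_wf P s G (rcons D (x, X)) ->
  exists s' z, [/\ s = rcons s' z, sub_wf P s' G D & (z, subst_sort s' D X) \in G].
Proof.
move eE: (rcons D _) => E w; case: w eE => {P s G E} [P G|P s G E z x' X' w tw].
  by move/(congr1 size); rewrite size_rcons.
case/rcons_inj => eD _ eX; rewrite {}eD {}eX; exists s, z; split=> //.
by case: tw.
Qed.

(** Each entry is typed with the substitution built before it, but the conclusion uses the whole
    one. The two agree because the arguments of [y] precede [y]. *)
Lemma sub_wf_inv S P s G Y b b' : valid S -> Y \in so S ->
  sa S Y = b ++ b' -> sub_wf P s G (map (ent S Y) b) ->
  forall y, y \in b ->
  (interp s (map (ent S Y) b) y,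
    (sh S Y y, [seq interp s (map (ent S Y) b) (sc S Y y z) | z <- sa S (sh S Y y)])) \in G.
Proof.
move=> vS Yo; elim/last_ind: b b' s => [|b x IH] b' s // ; rewrite cat_rcons => eb.
rewrite map_rcons => /sub_wf_rcons [s' [z [-> w zG]]] y yb.
have := uniq_sa vS Yo; rewrite eb cat_uniq => /and3P[_ /hasPn/(_ x (mem_head _ _)) /= xNb _].
have argb u : y \in rcons b x -> u \in sa S (sh S Y y) -> sc S Y y u \in b.
  rewrite mem_rcons inE => /orP[/eqP->|yb'] ua; first exact: mem_arg_prefix eb ua.
  have [b1 [b2 eb']] : exists b1 b2, b = b1 ++ y :: b2.
    by case/splitPr: yb' => b1 b2; exists b1, b2.
  rewrite eb' mem_cat; apply/orP; left; apply: (mem_arg_prefix vS Yo _ ua).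
  by rewrite eb eb' -catA.
rewrite interp_rcons.
(* The new last entry only affects the value at [x], and the arguments of [y] lie in [b], which
   omits [x]. *)
have -> : [seq interp (rcons s' z) (rcons (map (ent S Y) b) (ent S Y x)) (sc S Y y u)
          | u <- sa S (sh S Y y)] =
    [seq interp s' (map (ent S Y) b) (sc S Y y u) | u <- sa S (sh S Y y)].
  apply/eq_in_map => u /(argb u yb) cb; rewrite interp_rcons ifN //.
  by apply: contraNneq xNb => <-.
move: yb; rewrite mem_rcons inE; case: eqVneq => [-> _|_ /= yb]; last exact: IH eb w _ yb.
by move: zG; rewrite /subst_sort /subst_comp /= -map_comp.
Qed.

(** With [interp s (ctxt S Y) y] read as the composite of [y] after [f], this yields the category
    laws for a new top object. The index inequality holds because the sort of [f] is formed in the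
    context preceding [f]. *)
Lemma ctx_wf_inv S G : valid S -> ctx_wf (sigma S) G ->
  uniq (names G) /\ forall f Y s, (f, (Y, s)) \in G ->
    [/\ Y \in so S, size s = size (sa S Y) & forall y, y \in sa S Y ->
      (interp s (ctxt S Y) y,
        (sh S Y y, [seq interp s (ctxt S Y) (sc S Y y z) | z <- sa S (sh S Y y)])) \in G /\
      index (interp s (ctxt S Y) y) (names G) < index f (names G)].
Proof.
move=> vS; move eP: (sigma S) => P w; elim: w eP => // {P G} P G x X wG IH sX xNG eP.
have [uG HG] := IH eP; split; first by rewrite /names map_rcons rcons_uniq xNG.
have eN : names (rcons G (x, X)) = rcons (names G) x by rewrite /names map_rcons.
have lt_rcons u v : u \in names G -> index u (names G) < index v (names G) ->
    index u (rcons (names G) x) < index v (rcons (names G) x).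
  move=> uN; rewrite -cats1 !index_cat uN; case: ifP => // _ _.
  by rewrite ltn_addr // index_mem.
move=> f Y s; rewrite mem_rcons inE => /orP[/eqP[-> eX]|fG]; last first.
  have [Yo es H] := HG _ _ _ fG; split=> // y /H[yG lt]; split.
    by rewrite mem_rcons inE yG orbT.
  by rewrite eN; apply: lt_rcons lt; apply: (map_f fst yG).
case: sX eX eN => {P wG} P {}G A D t AP w eX eN in IH eP xNG uG HG lt_rcons *.
case: eX w AP eN => <- <- w AP eN; move: AP; rewrite -eP /sigma mem_sigma_on => /andP[Yo /eqP eD].
rewrite {}eD in w; split=> //; first by rewrite (size_sub_wf w) size_map.
move=> y ya; have yG := sub_wf_inv vS Yo (esym (cats0 _)) w ya.
split; first by rewrite mem_rcons inE yG orbT.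
have yN : interp s (ctxt S Y) y \in names G by exact: (map_f fst yG).
rewrite eN -cats1 !index_cat yN (negPf xNG) /= eqxx addn0 index_mem //.
Qed.

Definition update (T : Type) (F : nat -> T) (A : nat) (t : T) (K : nat) : T :=
  if K == A then t else F K.

Lemma update_eq T (F : nat -> T) A t : update F A t A = t.
Proof. by rewrite /update eqxx. Qed.

Lemma update_neq T (F : nat -> T) A t K : K != A -> update F A t K = F K.
Proof. by rewrite /update => /negPf->. Qed.

(** A substitution is recovered from its values on distinct names, so the arguments of an entry
    really are the list of its composites. *)
Lemma interp_nth s (D : seq (nat * (nat * seq nat))) : size s = size D -> uniq (names D) ->
  [seq interp s D y | y <- names D] = s.
Proof.
elim/last_ind: D s => [|D [x X] IH] s; first by case: s.
case/lastP: s => [|s z]; rewrite !size_rcons // => -[es].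
rewrite {1 2}/names map_rcons rcons_uniq => /andP[xND uD].
rewrite map_rcons interp_rcons eqxx; congr rcons; rewrite -[RHS](IH s es uD).
by apply/eq_in_map => y yD; rewrite interp_rcons ifN //; apply: contraNneq xND => <-.
Qed.

Lemma ctx_lookupP (G : seq (nat * (nat * seq nat))) f X :
  uniq (names G) -> (f, X) \in G -> ctx_lookup G f = X.
Proof.
elim: G => //= -[x Y] G IH /=; rewrite /names /= => /andP[xN uG].
rewrite inE /ctx_lookup /= => /orP[/eqP[-> ->]|fG]; first by rewrite eqxx.
have fN : f \in names G by exact: (map_f fst fG).
rewrite ifN; first exact: IH.
by apply: contraNneq xN => ->.
Qed.

Lemma mem_ctx_lookup (G : seq (nat * (nat * seq nat))) f :
  f \in names G -> (f, ctx_lookup G f) \in G.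
Proof.
elim: G => //= -[x Y] G IH; rewrite !inE /ctx_lookup /= [x == f]eq_sym.
case: (eqVneq f x) => [-> _|nfx] /=; first by rewrite eqxx.
by move=> fG; apply/orP; right; apply: IH.
Qed.

Lemma wf_sigma P : sig_wf P -> exists2 S, valid S & P = sigma S.
Proof.
elim=> [|{}P A G _ [S vS eP] wG AN].
  by exists (Str [::] (fun=> [::]) (fun _ _ => 0) (fun _ _ _ => 0)).
rewrite {}eP /sigma sig_names_sigma_on in wG AN *.
have [uG HG] := ctx_wf_inv vS wG.
(* The new object [A] gets the variables of [G] as its arrows, head sorts as codomains and the
   action of the substitutions as composition; older objects keep their data. *)
pose hG f := (ctx_lookup G f).1.
pose cG f y := interp (ctx_lookup G f).2 (ctxt S (hG f)) y.
pose S' := Str (rcons (so S) A) (update (sa S) A (names G)) (update (sh S) A hG)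
               (update (sc S) A cG).
have neqA K : K \in so S -> K != A by move=> Ko; apply: contraNneq AN => <-.
have saA : sa S' A = names G by rewrite /= update_eq.
have shA : sh S' A = hG by rewrite /= update_eq.
have scA : sc S' A = cG by rewrite /= update_eq.
have saK K : K \in so S -> sa S' K = sa S K by move=> /neqA nK /=; rewrite update_neq.
have shK K : K \in so S -> sh S' K = sh S K by move=> /neqA nK /=; rewrite update_neq.
have scK K : K \in so S -> sc S' K = sc S K by move=> /neqA nK /=; rewrite update_neq.
have HG' f : f \in names G -> [/\ hG f \in so S, (ctx_lookup G f).2 = [seq cG f y | y <- sa S (hG f)] &
    forall y, y \in sa S (hG f) -> [/\ cG f y \in names G, index (cG f y) (names G) < index f (names G) &
      ctx_lookup G (cG f y) = (sh S (hG f) y, [seq cG f (sc S (hG f) y z) | z <- sa S (sh S (hG f) y)])]].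
  move=> fN; have := mem_ctx_lookup fN; rewrite [ctx_lookup G f]surjective_pairing => /HG.
  rewrite -/(hG f) => -[Yo es H]; split=> //.
    rewrite -[LHS](@interp_nth _ (ctxt S (hG f))) ?names_ctxt //; first by rewrite es size_map.
    by apply: uniq_sa.
  move=> y ya; have [yG lt] := H y ya; split=> //; first exact: (map_f fst yG).
  exact: ctx_lookupP.
have oP K : K \in so S' -> K = A \/ K \in so S.
  by rewrite mem_rcons inE => /orP[/eqP|]; [left|right].
have memo K : K \in so S -> K \in so S' by move=> Ko; rewrite mem_rcons inE Ko orbT.
exists S'; last first.
  rewrite /sigma_on map_rcons; congr rcons.
    apply/eq_in_map => K Ko; congr pair; rewrite /ctxt saK //.
    apply/eq_in_map => f fa; rewrite /ent shK // scK // saK //; exact: sh_so.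
  congr pair; rewrite /ctxt saA.
  rewrite -[LHS]map_id /names -map_comp; apply/eq_in_map => -[f [Y s]] fG /=.
  have fN : f \in names G by exact: (map_f fst fG).
  have [Yo es _] := HG' _ fN; rewrite /ent shA scA saK // -es -surjective_pairing.
  by rewrite (ctx_lookupP uG fG).
have idx K : K \in so S -> index K (so S') = index K (so S).
  by move=> Ko; rewrite /= -cats1 index_cat Ko.
split.
- by rewrite rcons_uniq AN uniq_so.
- by move=> K /oP[->|Ko]; rewrite ?saA // saK // uniq_sa.
- move=> K f /oP[->|Ko]; first by rewrite saA shA => /HG'[Yo _ _]; apply: memo.
  by rewrite saK // shK // => fa; apply: memo; apply: sh_so.
- move=> K f /oP[->|Ko].
    rewrite saA shA => /HG'[Yo _ _]; rewrite idx //= -cats1 index_cat (negPf AN) /=.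
    by rewrite eqxx addn0 index_mem.
  by rewrite saK // shK // => fa; rewrite !idx //; [apply: sh_lt|apply: sh_so].
- move=> K f y /oP[->|Ko].
    by rewrite saA shA scA => /HG'[Yo _ H]; rewrite saK // => /H[].
  rewrite saK // shK // scK // => fa; rewrite saK; [exact: sc_sa|exact: sh_so].
- move=> K f y /oP[->|Ko].
    by rewrite saA shA scA => /HG'[Yo _ H]; rewrite saK // => /H[].
  rewrite saK // shK // scK // => fa; rewrite saK; [exact: sc_lt|exact: sh_so].
- move=> K f y /oP[->|Ko].
    by rewrite saA shA scA => /HG'[Yo _ H]; rewrite saK // shK // => /H[_ _ e]; rewrite {1}/hG e.
  rewrite saK // shK // scK // => fa; rewrite saK ?shK; [exact: sh_sc|exact: sh_so|exact: sh_so].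
- move=> K f y z /oP[->|Ko].
    rewrite saA shA scA => /HG'[Yo _ H]; rewrite saK // shK // scK // => ya.
    have Zo := sh_so vS Yo ya; rewrite saK // => za.
    (* The arguments of the entry [cG f y] are known twice: from [e] as composites of [f], from [e2]
       as composites of [cG f y]. Equating the lists entrywise is associativity. *)
    have [cN _ e] := H y ya; have [_ e2 _] := HG' _ cN.
    have eh : hG (cG f y) = sh S (hG f) y by rewrite {1}/hG e.
    move: e2; rewrite e eh /= => /esym/eq_in_map -> //.
  rewrite saK // shK // scK // => fa; have Yo := sh_so vS Ko fa.
  rewrite saK // shK // scK // => ya; rewrite saK; [exact: sc_sc|exact: sh_so].
Qed.

(* Isomorphism of the underlying categories, forgetting the orders. *)
Record sim (fo : nat -> nat) (ga : nat -> nat -> nat) (S S' : str) : Prop := Sim {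
  sim_fo_inj : {in so S &, injective fo};
  sim_so : perm_eq (map fo (so S)) (so S');
  sim_ga_inj : forall K, K \in so S -> {in sa S K &, injective (ga K)};
  sim_sa : forall K, K \in so S -> perm_eq (map (ga K) (sa S K)) (sa S' (fo K));
  sim_sh : forall K f, K \in so S -> f \in sa S K ->
    sh S' (fo K) (ga K f) = fo (sh S K f);
  sim_sc : forall K f y, K \in so S -> f \in sa S K -> y \in sa S (sh S K f) ->
    sc S' (fo K) (ga K f) (ga (sh S K f) y) = ga K (sc S K f y)
}.

Definition similar (S S' : str) : Prop := exists fo ga, sim fo ga S S'.

Lemma similar_trans S1 S2 S3 : valid S1 ->
  similar S1 S2 -> similar S2 S3 -> similar S1 S3.
Proof.
move=> vS [fo [ga s12]] [fo' [ga' s23]].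
have so2 K : K \in so S1 -> fo K \in so S2.
  by move=> Ko; rewrite -(perm_mem (sim_so s12)) map_f.
have sa2 K f : K \in so S1 -> f \in sa S1 K -> ga K f \in sa S2 (fo K).
  by move=> Ko fa; rewrite -(perm_mem (sim_sa s12 Ko)) map_f.
exists (fo' \o fo), (fun K => ga' (fo K) \o ga K); split.
- move=> K L Ko Lo /= /(sim_fo_inj s23 (so2 _ Ko) (so2 _ Lo)); exact: sim_fo_inj s12 _ _ Ko Lo.
- by rewrite map_comp -(permPr (sim_so s23)) perm_map // (sim_so s12).
- move=> K Ko f g fa ga1 /= /(sim_ga_inj s23 (so2 _ Ko) (sa2 _ _ Ko fa) (sa2 _ _ Ko ga1)).
  exact: sim_ga_inj s12 _ Ko _ _ fa ga1.
- by move=> K Ko; rewrite map_comp -(permPr (sim_sa s23 (so2 _ Ko))) perm_map // sim_sa.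
- by move=> K f Ko fa /=; rewrite (sim_sh s23) ?so2 ?sa2 // (sim_sh s12).
- move=> K f y Ko fa ya /=; have Yo := sh_so vS Ko fa.
  rewrite -(sim_sh s12 Ko fa) (sim_sc s23) ?so2 ?sa2 //; first by rewrite (sim_sc s12).
  by rewrite (sim_sh s12 Ko fa) sa2.
Qed.

Lemma similar_refl S : similar S S.
Proof.
by exists id, (fun=> id); split=> // [|K _ f g|K _]; rewrite ?map_id.
Qed.

Lemma sim_so_mem fo ga S S' K' : sim fo ga S S' -> K' \in so S' ->
  exists2 K, K \in so S & K' = fo K.
Proof. by move=> s; rewrite -(perm_mem (sim_so s)) => /mapP. Qed.

Lemma sim_sa_mem fo ga S S' K f' : sim fo ga S S' -> K \in so S ->
  f' \in sa S' (fo K) -> exists2 f, f \in sa S K & f' = ga K f.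
Proof. by move=> s Ko; rewrite -(perm_mem (sim_sa s Ko)) => /mapP. Qed.

(** The category laws do not see the orders and pass along [sim], as every object and arrow of [S']
    is an image. Only the two order conditions remain to be checked. *)
Lemma valid_sim fo ga S S' : valid S -> sim fo ga S S' ->
  (forall K f, K \in so S -> f \in sa S K ->
     index (fo (sh S K f)) (so S') < index (fo K) (so S')) ->
  (forall K f y, K \in so S -> f \in sa S K -> y \in sa S (sh S K f) ->
     index (ga K (sc S K f y)) (sa S' (fo K)) < index (ga K f) (sa S' (fo K))) ->
  valid S'.
Proof.
move=> vS s Ho Ha.
have so' K : K \in so S -> fo K \in so S'.
  by move=> Ko; rewrite -(perm_mem (sim_so s)) map_f.
have sa' K f : K \in so S -> f \in sa S K -> ga K f \in sa S' (fo K).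
  by move=> Ko fa; rewrite -(perm_mem (sim_sa s Ko)) map_f.
split.
- by rewrite -(perm_uniq (sim_so s)) (map_inj_in_uniq (sim_fo_inj s)) uniq_so.
- move=> _ /(sim_so_mem s)[K Ko ->].
  by rewrite -(perm_uniq (sim_sa s Ko)) (map_inj_in_uniq (sim_ga_inj s Ko)) uniq_sa.
- move=> _ _ /(sim_so_mem s)[K Ko ->] /(sim_sa_mem s Ko)[f fa ->].
  by rewrite (sim_sh s) // so' // sh_so.
- move=> _ _ /(sim_so_mem s)[K Ko ->] /(sim_sa_mem s Ko)[f fa ->].
  by rewrite (sim_sh s) // Ho.
- move=> _ _ y' /(sim_so_mem s)[K Ko ->] /(sim_sa_mem s Ko)[f fa ->].
  have Yo := sh_so vS Ko fa; rewrite (sim_sh s) // => /(sim_sa_mem s Yo)[y ya ->].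
  by rewrite (sim_sc s) // sa' // sc_sa.
- move=> _ _ y' /(sim_so_mem s)[K Ko ->] /(sim_sa_mem s Ko)[f fa ->].
  have Yo := sh_so vS Ko fa; rewrite (sim_sh s) // => /(sim_sa_mem s Yo)[y ya ->].
  by rewrite (sim_sc s) // Ha.
- move=> _ _ y' /(sim_so_mem s)[K Ko ->] /(sim_sa_mem s Ko)[f fa ->].
  have Yo := sh_so vS Ko fa; rewrite (sim_sh s) // => /(sim_sa_mem s Yo)[y ya ->].
  by rewrite (sim_sc s) // !(sim_sh s) ?sc_sa // (sh_sc vS).
- move=> _ _ y' z' /(sim_so_mem s)[K Ko ->] /(sim_sa_mem s Ko)[f fa ->].
  have Yo := sh_so vS Ko fa; rewrite (sim_sh s) // => /(sim_sa_mem s Yo)[y ya ->].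
  have Zo := sh_so vS Yo ya; rewrite (sim_sh s) // => /(sim_sa_mem s Zo)[z za ->].
  have cK := sc_sa vS Ko fa ya; have cY := sc_sa vS Yo ya za.
  rewrite (sim_sc s Yo ya za) (sim_sc s Ko fa cY) (sim_sc s Ko fa ya) -(sc_sc vS) //.
  by rewrite -(sim_sc s Ko cK) (sh_sc vS Ko fa ya).
Qed.

(** The functions of a structure carry arbitrary values off the actual objects and arrows; [sigma]
    reads only the meaningful ones. *)
Lemma eq_sigma_on S S' o :
  {in o, forall K, sa S K = sa S' K} ->
  (forall K f, K \in o -> f \in sa S K ->
     [/\ sh S K f = sh S' K f, sa S (sh S K f) = sa S' (sh S K f) &
         {in sa S (sh S K f), sc S K f =1 sc S' K f}]) ->
  sigma_on S o = sigma_on S' o.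
Proof.
move=> Ha H; apply/eq_in_map => K Ko; congr pair; rewrite /ctxt -Ha //.
apply/eq_in_map => f fa; have [eh ea ec] := H K f Ko fa.
by rewrite /ent -eh -ea; do 2!congr pair; apply/eq_in_map.
Qed.

(** * Changing the orders of a structure *)

Definition reorder (S : str) (o : seq nat) (a : nat -> seq nat) : str :=
  Str o a (sh S) (sc S).

Lemma sim_reorder S o a : perm_eq (so S) o ->
  {in so S, forall K, perm_eq (sa S K) (a K)} -> sim id (fun=> id) S (reorder S o a).
Proof. by move=> po pa; split=> // [|K _ f g|K Ko]; rewrite ?map_id //; apply: pa. Qed.

Lemma sigma_swap_step S o1 A B o2 a :
  (forall f, f \in a B -> sh S B f != A) ->
  (forall f, f \in a A -> sh S A f != B) ->
  sig_step (sigma (reorder S (o1 ++ A :: B :: o2) a))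
           (sigma (reorder S (o1 ++ B :: A :: o2) a)).
Proof.
move=> HB HA; rewrite /sigma /sigma_on !map_cat /=.
by apply: step_swap; apply/allP => e /mapP[f fa ->]; [apply: HB|apply: HA].
Qed.

Lemma swap_at_map (F : nat -> nat) a1 x y a2 :
  swap_at (size a1) (map F (a1 ++ x :: y :: a2)) = map F (a1 ++ y :: x :: a2).
Proof.
rewrite /swap_at !map_cat size_cat !size_map /= ifT; last first.
  by rewrite addnS ltnS addnS ltnS leq_addr.
rewrite -(size_map F a1) take_size_cat // !nth_cat ltnn subnn.
rewrite [_ < _]ltnNge leqnSn /= subSnn /=; congr (_ ++ [:: _, _ & _]).
by rewrite drop_cat ltnNge leqW //= subSn // subSnn /= drop0.
Qed.

Section ContextSwap.
Variables (S S' : str) (A : nat) (o1 o2 a1 a2 : seq nat) (x y : nat).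
Hypotheses (eo : so S = o1 ++ A :: o2) (AN1 : A \notin o1) (AN2 : A \notin o2).
Hypothesis ea : sa S A = a1 ++ x :: y :: a2.
Hypotheses (eo' : so S' = so S) (eh : sh S' = sh S) (ec : sc S' = sc S).
Hypothesis ea' : sa S' A = a1 ++ y :: x :: a2.
Hypothesis eK : forall K, K != A -> sa S' K = sa S K.
Hypothesis H1 : forall K f, K \in o1 -> f \in sa S K -> sh S K f != A.
Hypothesis HA : forall f, f \in sa S A -> sh S A f != A.

Lemma sigma_ctx_split : sigma S = sigma_on S o1 ++
  (A, map (ent S A) a1 ++ ent S A x :: ent S A y :: map (ent S A) a2) :: sigma_on S o2.
Proof. by rewrite /sigma /sigma_on eo map_cat /= {2}/ctxt ea map_cat. Qed.

(** Contexts before [A], and that of [A] itself, have no entry of sort [A] and keep their argument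
    lists; in later contexts the recomputed lists differ exactly by [swap_at] at the entries of sort
    [A]. *)
Lemma sigma_ctx_swap : sigma S' = sigma_on S o1 ++
  (A, map (ent S A) a1 ++ ent S A y :: ent S A x :: map (ent S A) a2) ::
  map (adjust_entry A (size a1)) (sigma_on S o2).
Proof.
have neqA (o : seq nat) K : A \notin o -> K \in o -> K != A.
  by move=> AN Ko; apply: contraNneq AN => <-.
have entE K f : sh S K f != A -> ent S' K f = ent S K f.
  by move=> nA; rewrite /ent eh ec eK.
rewrite /sigma /sigma_on eo' eo map_cat /=; congr (_ ++ (_, _) :: _).
- apply/eq_in_map => K Ko; congr pair; rewrite /ctxt eK ?(neqA _ _ AN1 Ko) //.
  by apply/eq_in_map => f fa; rewrite entE // H1.
- rewrite /ctxt ea' -[RHS](map_cat _ a1 (y :: x :: a2)); apply/eq_in_map => f fa.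
  by rewrite entE // HA // ea (perm_mem (perm_swap _ _ _ _)).
- rewrite -map_comp; apply/eq_in_map => K Ko /=; have nK := neqA _ _ AN2 Ko.
  rewrite /adjust_entry /=; congr pair; rewrite /ctxt eK //.
  rewrite -map_comp; apply/eq_map => f /=; rewrite /ent /adjust_sort eh ec /=.
  case: eqP => [->|/eqP nA]; last by rewrite eK.
  by rewrite ea ea' swap_at_map.
Qed.

Lemma sigma_ctx_step :
  x \notin [seq sc S A y z | z <- sa S (sh S A y)] ->
  y \notin [seq sc S A x z | z <- sa S (sh S A x)] ->
  sig_step (sigma S) (sigma S').
Proof.
by move=> Hx Hy; rewrite sigma_ctx_split sigma_ctx_swap -(size_map (ent S A)); apply: step_ctx.
Qed.
End ContextSwap.

(** * Congruence and alpha-equivalence *)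

Definition rename_sig (fo : nat -> nat) (ga : nat -> nat -> nat) (P : Sig) : Sig :=
  [seq rename_entry fo (ga e.1) e | e <- P].

(** The structure on the image of the renaming, with both orders carried over; this is what an alpha
    step does to a signature. *)
Definition transport (fo : nat -> nat) (ga : nat -> nat -> nat) (S : str) : str :=
  let ob := inv_on fo (so S) in
  let ar K := inv_on (ga K) (sa S K) in
  Str (map fo (so S))
      (fun K' => map (ga (ob K')) (sa S (ob K')))
      (fun K' f' => fo (sh S (ob K') (ar (ob K') f')))
      (fun K' f' y' => let K := ob K' in let f := ar K f' in
                       ga K (sc S K f (ar (sh S K f) y'))).

Section Transport.
Variables (fo : nat -> nat) (ga : nat -> nat -> nat) (S : str).
Hypothesis vS : valid S.
Hypothesis foI : {in so S &, injective fo}.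
Hypothesis gaI : forall K, K \in so S -> {in sa S K &, injective (ga K)}.

Lemma transport_sa K : K \in so S -> sa (transport fo ga S) (fo K) = map (ga K) (sa S K).
Proof. by move=> Ko; rewrite /= (inv_onK foI). Qed.

Lemma sim_transport : sim fo ga S (transport fo ga S).
Proof.
split=> // [K Ko|K f Ko fa|K f y Ko fa ya]; first by rewrite transport_sa.
  by rewrite /= (inv_onK foI) // (inv_onK (gaI Ko)).
have Yo := sh_so vS Ko fa.
by rewrite /= (inv_onK foI) // (inv_onK (gaI Ko)) // (inv_onK (gaI Yo)).
Qed.

Lemma valid_transport : valid (transport fo ga S).
Proof.
apply: (valid_sim vS sim_transport) => [K f Ko fa|K f y Ko fa ya].
  by rewrite !index_map_in ?sh_so //; apply: sh_lt.
have cK := sc_sa vS Ko fa ya.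
by rewrite transport_sa // !index_map_in //; [apply: sc_lt|apply: gaI|apply: gaI].
Qed.

Lemma sigma_transport : sigma (transport fo ga S) = rename_sig fo ga (sigma S).
Proof.
rewrite /rename_sig /sigma /sigma_on -!map_comp; apply/eq_in_map => K Ko /=.
rewrite /rename_entry /=; congr pair.
rewrite {1}/ctxt transport_sa // -!map_comp; apply/eq_in_map => f fa /=.
rewrite /ent (sim_sh sim_transport) // transport_sa ?sh_so //=; do 2!congr pair.
rewrite -!map_comp; apply/eq_in_map => y ya.
exact: (sim_sc sim_transport).
Qed.
End Transport.

Lemma alpha_rename_sig fo ga P : injective fo -> (forall K, injective (ga K)) ->
  alpha P (rename_sig fo ga P).
Proof.
move=> foI gaI; exists fo; split=> //; split; first by rewrite size_map.
move=> i ltiP; exists (ga (nth (0, [::]) P i).1); split=> //.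
by rewrite (nth_map (0, [::])).
Qed.

(** [alpha] indexes its renamings by position; distinct objects allow indexing by sort name instead.
    Off the objects the identity keeps each [ga K] injective. *)
Lemma alpha_sigma S P' : uniq (so S) -> alpha (sigma S) P' ->
  exists fo ga, [/\ injective fo, forall K, injective (ga K) & P' = rename_sig fo ga (sigma S)].
Proof.
move=> uS [fo [foI [es H]]]; have [F HF] := choose_below id H.
pose ga K x := if K \in so S then F (index K (so S)) x else x.
have szS : size (sigma S) = size (so S) by rewrite size_map.
exists fo, ga; split=> // [K|].
  move=> x1 x2; rewrite /ga; case: ifP => // Ko.
  by have [|gI _] := HF (index K (so S)); [rewrite szS index_mem|apply: gI].
apply: (@eq_from_nth _ (0, [::])); first by rewrite size_map es.
rewrite -es => i lti; have [_ ->] := HF _ lti; rewrite (nth_map (0, [::])) //.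
rewrite szS in lti; rewrite /sigma /sigma_on (nth_map 0) //= /rename_entry /=.
by congr pair; apply/eq_map => p; rewrite /ga mem_nth // index_uniq.
Qed.

(** An injection of [nat] may have no injective left inverse at all (the successor has none), but
    one that inverts it on a finite set always exists. *)
Lemma finite_left_inverse (f : nat -> nat) (s : seq nat) : injective f ->
  exists2 h, injective h & {in s, cancel f h}.
Proof.
move=> fI; have fK : {in s, cancel f (inv_on f s)} by apply: inv_onK => x y _ _ /fI.
exists (extend (inv_on f s) (map f s)) => [|x xs]; last by rewrite extend_in ?map_f ?fK.
by apply: extend_inj => _ _ /mapP[x xs ->] /mapP[y ys ->]; rewrite !fK // => ->.
Qed.

Lemma rename_entryK fo fo' g g' (e : nat * Ctx) :
  {in e.1 :: [seq p.2.1 | p <- e.2], cancel fo fo'} ->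
  {in flatten [seq p.1 :: p.2.2 | p <- e.2], cancel g g'} ->
  rename_entry fo' g' (rename_entry fo g e) = e.
Proof.
case: e => K G /= foK gK; rewrite /rename_entry /= foK ?mem_head //; congr pair.
rewrite -map_comp -[RHS]map_id; apply/eq_in_map => -[x [Y s]] xG /=.
have gK' z : z \in x :: s -> g' (g z) = z.
  by move=> zs; apply: gK; apply/flattenP; exists (x :: s) => //; apply: (map_f _ xG).
rewrite gK' ?mem_head // foK; last by rewrite inE (map_f (fun p => p.2.1) xG) orbT.
do 2!congr pair; rewrite -map_comp -[RHS]map_id; apply/eq_in_map => z zs /=.
by rewrite gK' // inE zs orbT.
Qed.

Lemma alpha_sym P P' : alpha P P' -> alpha P' P.
Proof.
move=> [fo [foI [es H]]].
(* The finite set consists of all sort names occurring in [P], declared or as heads; below, of all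
   variables occurring in one entry. *)
have [fo' foI' foK] := finite_left_inverse
  (flatten [seq e.1 :: [seq p.2.1 | p <- e.2] | e <- P]) foI.
exists fo'; split=> //; split=> // i; rewrite -es => lti; have [g [gI ->]] := H i lti.
set e := nth _ _ _; have eP : e \in P by apply: mem_nth.
have [g' gI' gK] := finite_left_inverse (flatten [seq p.1 :: p.2.2 | p <- e.2]) gI.
exists g'; split=> //; rewrite rename_entryK // => z ze; apply: foK.
apply/flattenP; exists (e.1 :: [seq p.2.1 | p <- e.2]) => //.
exact: (map_f (fun e => e.1 :: [seq p.2.1 | p <- e.2])).
Qed.

Lemma swap_atK i : involutive (swap_at i).
Proof.
move=> s; rewrite {2}/swap_at; case: ifP => lt; last by rewrite /swap_at lt.
set t := take i s; have st : size t = i by rewrite size_takel // ltnW // ltnW.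
have := swap_at_map id t (nth 0 s i.+1) (nth 0 s i) (drop i.+2 s).
rewrite !map_id st => ->.
by rewrite -!drop_nth ?cat_take_drop // ltnW.
Qed.

Lemma adjust_entryK A i : involutive (adjust_entry A i).
Proof.
case=> K G; rewrite /adjust_entry /=; congr pair.
rewrite -map_comp -[RHS]map_id; apply/eq_map => -[x [Y s]] /=; congr pair.
by rewrite /adjust_sort /=; case: (eqVneq Y A) => [->|nA] /=; rewrite ?eqxx ?(negPf nA) ?swap_atK.
Qed.

Lemma sig_step_sym P P' : sig_step P P' -> sig_step P' P.
Proof.
case=> {P P'} [P1 P2 A G B D HA HB|P1 P2 A G1 G2 x X y Y Hx Hy|P P' a].
- exact: step_swap.
- have := @step_ctx P1 (map (adjust_entry A (size G1)) P2) A G1 G2 y Y x X Hy Hx.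
  by rewrite (mapK (adjust_entryK A _)).
- by apply: step_alpha; apply: alpha_sym.
Qed.

(** Each kind of step is realised on structures: [step_swap] reorders objects, [step_ctx] reorders
    arrows out of one object, [step_alpha] transports. *)
Lemma sig_step_sigma S P' : valid S -> sig_step (sigma S) P' ->
  exists S', [/\ valid S', P' = sigma S' & similar S S'].
Proof.
move=> vS; move eP: (sigma S) => P st; case: st eP => {P P'}
  [P1 P2 A G B D HA HB|P1 P2 A G1 G2 x X y Y Hx Hy|P P' a] eP.
- have [o1 [r [eo e1]]] := map_eq_cat eP.
  case: r eo => [|A' [|B' o2]] //= eo [eA eG eB eD e2].
  rewrite -{}eA -{}eB -{}eG -{}eD -{}e1 -{}e2 in eP HA HB *.
  set S' := reorder S (o1 ++ B' :: A' :: o2) (sa S).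
  have s : sim id (fun=> id) S S' by apply: sim_reorder => //; rewrite eo perm_swap.
  exists S'; split; last by exists id, (fun=> id).
    apply: (valid_sim vS s); last by move=> K f y; apply: (sc_lt vS).
    move=> K f Ko fa /=; have := sh_lt vS Ko fa; rewrite {1 2}eo.
    apply: index_swap; first by rewrite -eo uniq_so.
    (* The exceptional pair of [index_swap] would be an arrow from [B'] to [A'], contradicting the
       freshness of [A'] in the context of [B']. *)
    move=> [hA KB]; have /allP/(_ (ent S B' f)) := HA; rewrite -KB map_f // => /(_ isT).
    by rewrite /= hA eqxx.
  by rewrite /S' /sigma /sigma_on map_cat.
- have [o1 [r [eo e1]]] := map_eq_cat eP.
  case: r eo => [|A' o2] //= eo [eA eG e2]; subst A'.
  have Ao : A \in so S by rewrite eo mem_cat mem_head orbT.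
  have [a1 [r [ea g1]]] := map_eq_cat eG.
  case: r ea => [|x' [|y' a2]] //= ea [ex eX ey eY g2]; subst x' y'.
  set S' := reorder S (so S) (update (sa S) A (a1 ++ y :: x :: a2)).
  have s : sim id (fun=> id) S S'.
    apply: sim_reorder => // K Ko; rewrite /update; case: eqP => // ->.
    by rewrite ea perm_swap.
  have xA : x \in sa S A by rewrite ea mem_cat !inE eqxx orbT.
  have yA : y \in sa S A by rewrite ea mem_cat !inE eqxx !orbT.
  have hA f : f \in sa S A -> sh S A f != A.
    by move=> fa; have := sh_lt vS Ao fa; apply: contraTneq => ->; rewrite ltnn.
  have := uniq_so vS; rewrite {1}eo cat_uniq /= => /and3P[_ /norP[AN1 o21] /andP[AN2 _]].
  have vS' : valid S'.
    apply: (valid_sim vS s) => [K f|K f z Ko fa za]; first exact: (sh_lt vS).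
    have := sc_lt vS Ko fa za; rewrite /= /update; case: eqP => // KA.
    rewrite KA in Ko fa za *; rewrite {1 2}ea; apply: index_swap; first by rewrite -ea uniq_sa.
    (* Here the exceptional pair says that [x] is a composite through [y], hence an argument of [y],
       against freshness of [x]. *)
    move=> [cx fy]; move: Hx; rewrite /var_fresh -eY /= -{1}cx -fy => /negP; apply.
    exact: map_f.
  have H1 K f : K \in o1 -> f \in sa S K -> sh S K f != A.
    move=> K1 fa; have Ko : K \in so S by rewrite eo mem_cat K1.
    have := sh_lt vS Ko fa; apply: contraTneq => ->.
    by rewrite eo !index_cat K1 (negPf AN1) -leqNgt /= eqxx addn0 index_size.
  exists S'; split=> //; last by exists id, (fun=> id).
  rewrite -e1 -e2 -g1 -g2 -eX -eY size_map.
  apply/esym; apply: (sigma_ctx_swap eo AN1 AN2 ea) => //; first exact: update_eq.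
  by move=> K nK; rewrite /S' /= update_neq.
- rewrite -eP in a; have [fo [ga [foI gaI ->]]] := alpha_sigma (uniq_so vS) a.
  have foI' : {in so S &, injective fo} by move=> ? ? _ _ /foI.
  have gaI' K : K \in so S -> {in sa S K &, injective (ga K)} by move=> _ ? ? _ _ /gaI.
  exists (transport fo ga S); rewrite sigma_transport //; split=> //.
    exact: valid_transport.
  by exists fo, ga; apply: sim_transport.
Qed.

(** Stated in both directions so that the induction passes through the symmetry rule. Derivability
    of the intermediate signatures is not given but propagates along the chain. *)
Lemma sig_iso_sigma P P' : sig_iso P P' ->
  (forall S, valid S -> P = sigma S ->
     exists S', [/\ valid S', P' = sigma S' & similar S S']) /\
  (forall S', valid S' -> P' = sigma S' ->
     exists S, [/\ valid S, P = sigma S & similar S' S]).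
Proof.
elim=> {P P'} [P P' st|P|P P' _ [H1 H2]|P1 P2 P3 _ [H1 H1'] _ [H2 H2']] //.
- split=> S vS e; apply: (sig_step_sigma vS); rewrite -e //; exact: sig_step_sym.
- by split=> S vS e; exists S; split=> //; apply: similar_refl.
- split=> S vS e.
    have [S2 [v2 e2 s2]] := H1 S vS e; have [S3 [v3 e3 s3]] := H2 S2 v2 e2.
    by exists S3; split=> //; apply: similar_trans s2 s3.
  have [S2 [v2 e2 s2]] := H2' S vS e; have [S3 [v3 e3 s3]] := H1' S2 v2 e2.
  by exists S3; split=> //; apply: similar_trans s2 s3.
Qed.

(** * Compatible orders are connected by congruence steps *)

Lemma sig_iso_swaps (ind : nat -> nat -> Prop) (F : seq nat -> Sig) s t :
  (forall s1 a b s2, perm_eq s (s1 ++ a :: b :: s2) -> ind a b ->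
     sig_step (F (s1 ++ a :: b :: s2)) (F (s1 ++ b :: a :: s2))) ->
  swaps ind s t -> sig_iso (F s) (F t).
Proof.
move=> H st; suff [] : perm_eq s t /\ sig_iso (F s) (F t) by [].
elim: st => [|s1 a b s2 _ [p IH] iab]; first by split=> //; apply: rst_refl.
split; first by rewrite (permPl p) perm_swap.
by apply: rst_trans IH _; apply: rst_step; apply: H.
Qed.

(** If two compatible orders disagree on a pair of objects, an arrow between them in either
    direction would violate one of the orders; this is the independence required by [swaps_perm]. *)
Lemma sigma_reorder_objects S o a : valid S -> valid (reorder S o a) ->
  perm_eq (so S) o -> {in so S, forall K, perm_eq (sa S K) (a K)} ->
  sig_iso (sigma S) (sigma (reorder S o (sa S))).
Proof.
move=> vS vS' po pa; have -> : sigma S = sigma (reorder S (so S) (sa S)) by case: (S).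
pose ind A B := (forall f, f \in sa S B -> sh S B f != A) /\
                (forall f, f \in sa S A -> sh S A f != B).
apply: (@sig_iso_swaps ind (fun o => sigma (reorder S o (sa S)))).
  by move=> s1 A B s2 _ [HB HA]; apply: sigma_swap_step.
apply: swaps_perm => //; first exact: uniq_so.
move=> A B ltS lto Ao Bo; split=> f fa.
  have fa' : f \in a B by rewrite -(perm_mem (pa B Bo)).
  have Bo' : B \in o by rewrite -(perm_mem po).
  have := sh_lt vS' Bo' fa' => /=; apply: contraTneq => ->.
  by rewrite -leqNgt ltnW.
by have := sh_lt vS Ao fa; apply: contraTneq => ->; rewrite -leqNgt ltnW.
Qed.

(** The source is written with a trivial [update] so that both sides are values of one function of
    the list of arrows out of [A]. *)
Lemma sigma_reorder_arrows1 S A t : valid S -> A \in so S ->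
  perm_eq (sa S A) t ->
  (forall f z, f \in sa S A -> z \in sa S (sh S A f) -> index (sc S A f z) t < index f t) ->
  sig_iso (sigma (reorder S (so S) (update (sa S) A (sa S A))))
          (sigma (reorder S (so S) (update (sa S) A t))).
Proof.
move=> vS Ao pt Ht; have [o1 [o2 eo]] : exists o1 o2, so S = o1 ++ A :: o2.
  by case/splitPr: Ao => o1 o2; exists o1, o2.
have := uniq_so vS; rewrite {1}eo cat_uniq /= => /and3P[_ /norP[AN1 _] /andP[AN2 _]].
have hA f : f \in sa S A -> sh S A f != A.
  by move=> fa; have := sh_lt vS Ao fa; apply: contraTneq => ->; rewrite ltnn.
pose ind x y := (x \notin [seq sc S A y z | z <- sa S (sh S A y)]) /\
                (y \notin [seq sc S A x z | z <- sa S (sh S A x)]).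
apply: (@sig_iso_swaps ind (fun t => sigma (reorder S (so S) (update (sa S) A t)))).
  move=> s1 x y s2 p [ix iy].
  have xA : x \in sa S A by rewrite (perm_mem p) mem_cat !inE eqxx orbT.
  have yA : y \in sa S A by rewrite (perm_mem p) mem_cat !inE eqxx !orbT.
  apply: (sigma_ctx_step (S := reorder _ _ _) (A := A) eo AN1 AN2) => //.
  - exact: update_eq.
  - exact: update_eq.
  - by move=> K nK; rewrite /= !update_neq.
  - move=> K f K1 /=; rewrite update_neq; last by apply: contraNneq AN1 => <-.
    move=> fa; have Ko : K \in so S by rewrite eo mem_cat K1.
    have := sh_lt vS Ko fa; apply: contraTneq => ->.
    by rewrite eo !index_cat K1 (negPf AN1) -leqNgt /= eqxx addn0 index_size.
  - by move=> f /=; rewrite update_eq -(perm_mem p); apply: hA.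
  - by rewrite /= update_neq // hA.
  - by rewrite /= update_neq // hA.
apply: swaps_perm => //; first exact: uniq_sa.
move=> x y ltS ltt xA yA; split; apply/mapP => -[z za e].
  by have := Ht y z yA za; rewrite -e ltnNge ltnW.
by have := sc_lt vS Ao xA za; rewrite -e ltnNge ltnW.
Qed.

Lemma sigma_reorder_arrows S a : valid S -> valid (reorder S (so S) a) ->
  {in so S, forall K, perm_eq (sa S K) (a K)} ->
  sig_iso (sigma S) (sigma (reorder S (so S) a)).
Proof.
(* [mix r] uses the new order on the objects of [r] and the old one elsewhere. It stays valid
   because [sc_lt] at [K] only involves the order at [K], so the objects can be treated one at a
   time. *)
move=> vS vS' pa; pose mix (r : seq nat) K := if K \in r then a K else sa S K.
have ext b b' : {in so S, b =1 b'} -> (forall K, K \in so S -> perm_eq (sa S K) (b K)) ->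
    sigma (reorder S (so S) b) = sigma (reorder S (so S) b').
  move=> e pb; apply: eq_sigma_on => [K Ko|K f Ko fa] /=; first exact: e.
  by split=> //; apply: e; apply: sh_so => //; rewrite (perm_mem (pb K Ko)).
have pm r K : K \in so S -> perm_eq (sa S K) (mix r K).
  by move=> Ko; rewrite /mix; case: ifP => // _; apply: pa.
have vm r : valid (reorder S (so S) (mix r)).
  apply: (valid_sim vS (sim_reorder (perm_refl _) (pm r))) => /= [K f|K f y Ko fa ya].
    exact: sh_lt.
  rewrite /mix; case: ifP => _; last exact: sc_lt.
  apply: (sc_lt vS'); rewrite //= -?(perm_mem (pa _ _)) //; exact: sh_so.
suff H r : {subset r <= so S} -> sig_iso (sigma S) (sigma (reorder S (so S) (mix r))).
  rewrite -(@ext (mix (so S)) a); [exact: H| |exact: pm].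
  by move=> K Ko; rewrite /mix Ko.
elim: r => [|A r IH] Hr.
  by rewrite (@ext _ (sa S)); [case: (S) => *; apply: rst_refl| |exact: pm].
have Ao : A \in so S by apply: Hr; rewrite mem_head.
apply: rst_trans (IH _) _; first by move=> K Kr; apply: Hr; rewrite inE Kr orbT.
have -> : sigma (reorder S (so S) (mix r)) =
    sigma (reorder S (so S) (update (mix r) A (mix r A))).
  by apply: ext; [move=> K _; rewrite /update; case: eqP => [->|]|exact: pm].
have -> : sigma (reorder S (so S) (mix (A :: r))) =
    sigma (reorder S (so S) (update (mix r) A (a A))).
  apply: ext; [move=> K _|exact: pm].
  by rewrite /update /mix inE; case: eqP => [->|].
apply: (sigma_reorder_arrows1 (vm r) Ao) => /=.
  by rewrite -(permPl (pm r A Ao)) pa.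
move=> f z; rewrite -(perm_mem (pm r A Ao)) => fa; have Yo := sh_so vS Ao fa.
rewrite -(perm_mem (pm r _ Yo)) => za.
by apply: (sc_lt vS'); rewrite //= -(perm_mem (pa _ _)).
Qed.

Lemma sigma_reorder S o a : valid S -> valid (reorder S o a) ->
  perm_eq (so S) o -> {in so S, forall K, perm_eq (sa S K) (a K)} ->
  sig_iso (sigma S) (sigma (reorder S o a)).
Proof.
move=> vS vS' po pa; apply: rst_trans (sigma_reorder_objects vS vS' po pa) _.
apply: (@sigma_reorder_arrows (reorder S o (sa S))) => //=; last first.
  by move=> K; rewrite -(perm_mem po); apply: pa.
(* The intermediate structure, with new object order and old arrow orders, is valid since [sh_lt]
   concerns only the former and [sc_lt] only the latter. *)
apply: (valid_sim vS (sim_reorder po _)) => //= [K f Ko fa|K f y]; last exact: sc_lt.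
by apply: (sh_lt vS'); rewrite //= -?(perm_mem po) -?(perm_mem (pa _ _)).
Qed.

(** An alpha step first transports [S] to [T], which has the same objects, arrows and composition as
    [S']; what remains is a difference of orders. *)
Lemma similar_sig_iso S S' : valid S -> valid S' -> similar S S' ->
  sig_iso (sigma S) (sigma S').
Proof.
move=> vS vS' [fo0 [ga0 s0]].
pose fo := extend fo0 (so S); pose ga K := extend (ga0 K) (sa S K).
have foI : injective fo by apply: extend_inj; apply: sim_fo_inj s0.
have foI' : {in so S &, injective fo} by move=> ? ? _ _ /foI.
have gaI' K : K \in so S -> {in sa S K &, injective (ga K)}.
  by move=> Ko ? ? _ _; apply: (extend_inj (sim_ga_inj s0 Ko)).
have foE : {in so S, fo =1 fo0} by apply: extend_in.
have gaE K : {in sa S K, ga K =1 ga0 K} by apply: extend_in.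
have s : sim fo ga S S'.
  split=> // [|K Ko|K f Ko fa|K f y Ko fa ya].
  - by rewrite (_ : map fo _ = map fo0 (so S)) ?(sim_so s0) //; apply/eq_in_map.
  - rewrite (_ : map _ _ = map (ga0 K) (sa S K)) ?foE ?(sim_sa s0) //.
    by apply/eq_in_map; apply: gaE.
  - by rewrite !foE ?gaE ?(sim_sh s0) //; apply: sh_so.
  - by rewrite foE // !gaE ?(sim_sc s0) //; apply: sc_sa.
set T := transport fo ga S.
have vT : valid T by apply: valid_transport.
have sT : sim fo ga S T by apply: sim_transport.
apply: rst_trans (_ : sig_iso _ (sigma T)) _.
  (* Injectivity of [ga K] is known only at objects, while [alpha_rename_sig] wants it for all [K];
     the identity fills in elsewhere. *)
  pose gb K := if K \in so S then ga K else id.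
  have gbI K : injective (gb K).
    rewrite /gb; case: ifP => [Ko|_]; last by move=> ? ?.
    exact: (extend_inj (sim_ga_inj s0 Ko)).
  apply: rst_step; apply: step_alpha; rewrite /T sigma_transport //.
  rewrite (_ : rename_sig fo ga _ = rename_sig fo gb (sigma S)); first exact: alpha_rename_sig.
  by apply/eq_in_map => -[K G]; rewrite mem_sigma_on => /andP[Ko _] /=; rewrite /gb Ko.
have hE K' f' : K' \in so S' -> f' \in sa S' K' -> sh T K' f' = sh S' K' f'.
  move=> /(sim_so_mem s)[K Ko ->] /(sim_sa_mem s Ko)[f fa ->].
  by rewrite (sim_sh s) // (sim_sh sT).
have cE K' f' y' : K' \in so S' -> f' \in sa S' K' -> y' \in sa S' (sh S' K' f') ->
    sc T K' f' y' = sc S' K' f' y'.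
  move=> /(sim_so_mem s)[K Ko ->] /(sim_sa_mem s Ko)[f fa ->].
  rewrite (sim_sh s) // => /(sim_sa_mem s (sh_so vS Ko fa))[y ya ->].
  by rewrite (sim_sc s) // (sim_sc sT).
have -> : sigma S' = sigma (reorder T (so S') (sa S')).
  apply: eq_sigma_on => // K f Ko fa; rewrite hE //; split=> // y ya.
  exact/esym/cE.
apply: sigma_reorder => //.
- apply: (@valid_sim id (fun=> id) S') => // [|K f|K f y]; [|exact: sh_lt|exact: sc_lt].
  by split=> //= [|? ? ?|*]; rewrite ?map_id // ?hE ?cE.
- exact: sim_so s.
- by move=> _ /mapP[K Ko ->]; rewrite transport_sa // (sim_sa s).
Qed.

(** * The assignments R and S *)

(** The bridge between the two encodings: every arrow of [C] has its own name, which determines its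
    source, and all composites of non-identity arrows are non-identity. *)
Record presents (C : fcat) (S : str) : Prop := Presents {
  pr_obs : perm_eq (obs C) (so S);
  pr_uniq : uniq (ars C);
  pr_dom : forall f, f \in ars C -> dom C f \in so S;
  pr_sa : forall K f, K \in so S -> (f \in sa S K) = (f \in ars C) && (dom C f == K);
  pr_cod : forall f, f \in ars C -> cod C f = sh S (dom C f) f;
  pr_comp : forall f g, f \in ars C -> g \in ars C -> cod C f = dom C g ->
    Defs.comp C g f = MArr (sc S (dom C f) f g)
}.

Lemma presents_mem C S f : presents C S -> f \in ars C -> f \in sa S (dom C f).
Proof. by move=> p fC; rewrite (pr_sa p) ?(pr_dom p) // fC eqxx. Qed.

Lemma presents_ars C S K f : presents C S -> K \in so S -> f \in sa S K ->
  f \in ars C /\ dom C f = K.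
Proof. by move=> p Ko; rewrite (pr_sa p _ Ko) => /andP[-> /eqP]. Qed.

Lemma presents_fic C S : presents C S -> valid S -> is_fic C.
Proof.
move=> p vS.
have memo K : (K \in obs C) = (K \in so S) by rewrite (perm_mem (pr_obs p)).
have cod_so f : f \in ars C -> cod C f \in so S.
  by move=> fC; rewrite (pr_cod p fC) (sh_so vS) ?(pr_dom p) ?(presents_mem p).
have compP f g : f \in ars C -> g \in ars C -> cod C f = dom C g ->
    g \in sa S (sh S (dom C f) f).
  by move=> fC gC e; rewrite -(pr_cod p fC) e (presents_mem p).
have compA f g : f \in ars C -> g \in ars C -> cod C f = dom C g ->
    let h := sc S (dom C f) f g in [/\ h \in ars C, dom C h = dom C f & cod C h = cod C g].
  move=> fC gC e h; have Ko := pr_dom p fC; have fa := presents_mem p fC.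
  have ga := compP _ _ fC gC e; have [hC dh] := presents_ars p Ko (sc_sa vS Ko fa ga).
  split=> //; rewrite (pr_cod p hC) dh (sh_sc vS Ko fa ga) -(pr_cod p fC) e.
  by rewrite -(pr_cod p gC).
have dom_neq f : f \in ars C -> dom C f <> cod C f.
  move=> fC e; have := sh_lt vS (pr_dom p fC) (presents_mem p fC).
  by rewrite -(pr_cod p fC) -e ltnn.
split; first by rewrite (perm_uniq (pr_obs p)) uniq_so.
split; first exact: pr_uniq p.
split; first by move=> f fC; rewrite !memo (pr_dom p) ?cod_so.
split; first by move=> f g fC gC e; rewrite (pr_comp p) //; apply: compA.
split.
  move=> f g h fC gC hC e1 e2 /=; rewrite (pr_comp p fC gC e1) (pr_comp p gC hC e2) /=.
  have [c1 d1 c1'] := compA _ _ fC gC e1; have [c2 d2 c2'] := compA _ _ gC hC e2.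
  rewrite (pr_comp p c1 hC) ?c1' // (pr_comp p fC c2) ?d2 // d1; congr MArr.
  have Ko := pr_dom p fC; have fa := presents_mem p fC; have ga := compP _ _ fC gC e1.
  have eY : sh S (dom C f) f = dom C g by rewrite -(pr_cod p fC).
  rewrite (sc_sc vS Ko fa ga) eY // -(pr_cod p gC) e2; exact: presents_mem.
split=> // f g fC gC e1 e2.
(* Skeletality: a composite is always an [MArr], so no pair of non-identity arrows is mutually
   inverse. *)
by rewrite (pr_comp p).
Qed.

Lemma similar_cat_iso C D S S' : presents C S -> presents D S' -> valid S ->
  similar S S' -> cat_iso C D.
Proof.
move=> p p' vS [fo [ga s]].
(* The maps given at each source are glued into one; it is injective because the images also
   determine the source. *)
pose fa f := ga (dom C f) f.
have memo K : (K \in obs C) = (K \in so S) by rewrite (perm_mem (pr_obs p)).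
have faP f : f \in ars C -> [/\ fa f \in ars D, dom D (fa f) = fo (dom C f) &
    fo (dom C f) \in so S'].
  move=> fC; have Ko := pr_dom p fC.
  have Ko' : fo (dom C f) \in so S' by rewrite -(perm_mem (sim_so s)) map_f.
  have : fa f \in sa S' (fo (dom C f)).
    by rewrite /fa -(perm_mem (sim_sa s Ko)) map_f // (presents_mem p).
  by move=> /(presents_ars p' Ko')[].
have codP f : f \in ars C -> cod D (fa f) = fo (cod C f).
  move=> fC; have [fD df _] := faP f fC.
  by rewrite (pr_cod p') // df (sim_sh s) ?(pr_dom p) ?(presents_mem p) // (pr_cod p).
have faI : {in ars C &, injective fa}.
  move=> f g fC gC e; have [_ df _] := faP f fC; have [_ dg _] := faP g gC.
  have ed : dom C f = dom C g.
    by apply: (sim_fo_inj s); rewrite ?(pr_dom p) // -df e dg.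
  apply: (sim_ga_inj s (pr_dom p fC)); rewrite ?(presents_mem p) //.
    by rewrite ed (presents_mem p).
  by move: e; rewrite /fa ed.
exists fo, fa; split; first by move=> K L; rewrite !memo; apply: (sim_fo_inj s).
split=> //; split.
  by rewrite (permPr (pr_obs p')) -(permPr (sim_so s)) perm_map // (pr_obs p).
split.
  apply: uniq_perm; first by rewrite (map_inj_in_uniq faI) (pr_uniq p).
    exact: pr_uniq p'.
  move=> f'; apply/mapP/idP => [[f fC ->]|fD]; first by have [] := faP f fC.
  have := pr_dom p' fD => /(sim_so_mem s)[K Ko eK].
  have := presents_mem p' fD; rewrite eK => /(sim_sa_mem s Ko)[f fK ->].
  by have [fC df] := presents_ars p Ko fK; exists f => //; rewrite /fa df.
split; first by move=> f fC; rewrite codP //; have [] := faP f fC.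
move=> f g fC gC e; have [fD df _] := faP f fC; have [gD dg _] := faP g gC.
rewrite (pr_comp p') //; last by rewrite codP // e dg.
rewrite (pr_comp p) //= df; congr MArr.
have Ko := pr_dom p fC; have fK := presents_mem p fC.
have gK : g \in sa S (sh S (dom C f) f) by rewrite -(pr_cod p fC) e (presents_mem p).
have [_ dh] := presents_ars p Ko (sc_sa vS Ko fK gK).
by rewrite {3}/fa dh -(sim_sc s Ko fK gK) -(pr_cod p fC) e.
Qed.

Lemma cat_iso_similar C D S S' : presents C S -> presents D S' -> valid S -> valid S' ->
  cat_iso C D -> similar S S'.
Proof.
move=> p p' vS vS' [fo [fa [foI [faI [po [pa [dc cc]]]]]]].
have memo K : (K \in obs C) = (K \in so S) by rewrite (perm_mem (pr_obs p)).
have pso : perm_eq (map fo (so S)) (so S').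
  by rewrite -(permPr (pr_obs p')) -(permPr po) perm_map // perm_sym (pr_obs p).
have so' K : K \in so S -> fo K \in so S' by move=> Ko; rewrite -(perm_mem pso) map_f.
have memaD f : f \in ars C -> fa f \in ars D by move=> fC; rewrite -(perm_mem pa) map_f.
have sub K f : K \in so S -> f \in sa S K -> f \in ars C /\ dom C f = K.
  exact: presents_ars.
have faK K : K \in so S -> {in sa S K &, injective fa}.
  by move=> Ko f g /(sub K f Ko)[fC _] /(sub K g Ko)[gC _]; apply: faI.
exists fo, (fun=> fa); split=> //.
- by move=> K L; rewrite -!memo; apply: foI.
- move=> K Ko; apply: uniq_perm; first by rewrite (map_inj_in_uniq (faK K Ko)) uniq_sa.
    by rewrite uniq_sa // so'.
  move=> f'; rewrite (pr_sa p' _ (so' _ Ko)); apply/mapP/andP => [[f fK ->]|[]].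
    have [fC df] := sub _ _ Ko fK; have [-> _] := dc f fC.
    by rewrite memaD // df.
  rewrite -(perm_mem pa) => /mapP[f fC ->]; have [-> _] := dc f fC => /eqP e.
  exists f => //; rewrite (pr_sa p) // fC; apply/eqP; apply: foI => //.
    by rewrite memo (pr_dom p).
  by rewrite memo.
- move=> K f Ko fK; have [fC df] := sub _ _ Ko fK; have [d c] := dc f fC.
  by rewrite -df -(pr_cod p fC) -c -d (pr_cod p') // memaD.
- move=> K f y Ko fK yK; have [fC df] := sub _ _ Ko fK; have [d c] := dc f fC.
  have [yC dy] := sub _ _ (sh_so vS Ko fK) yK; have [dy' _] := dc y yC.
  have e : cod C f = dom C y by rewrite dy (pr_cod p) // df.
  have := cc f y fC yC e; rewrite (pr_comp p) // (pr_comp p') ?memaD //.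
    by rewrite d df => -[].
  by rewrite c dy' e.
Qed.

Lemma cat_iso_refl C : cat_iso C C.
Proof.
exists id, id; rewrite !map_id; do 5!(split; first by []).
by move=> f g _ _ _; case: (Defs.comp C g f).
Qed.

Lemma sigma_eq_similar S S' : valid S -> sigma S = sigma S' -> similar S S'.
Proof.
move=> vS e.
have eo : so S = so S' by have := congr1 sig_names e; rewrite !sig_names_sigma_on.
have ec K : K \in so S -> ctxt S K = ctxt S' K.
  by move=> Ko; move: e; rewrite /sigma -eo => /eq_in_map/(_ K Ko)[].
have ea K : K \in so S -> sa S K = sa S' K.
  by move=> Ko; rewrite -names_ctxt ec // names_ctxt.
have ee K f : K \in so S -> f \in sa S K -> ent S K f = ent S' K f.
  move=> Ko fK; have := ec K Ko; rewrite /ctxt -ea // => /eq_in_map; exact.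
exists id, (fun=> id); split=> // [|K _ f g|K Ko|K f Ko fK|K f y Ko fK yK].
- by rewrite map_id eo.
- by [].
- by rewrite map_id ea.
- by have [] := ee K f Ko fK.
- have [eh] := ee K f Ko fK; rewrite -eh -ea; last exact: sh_so.
  by move=> /eq_in_map ->.
Qed.

Lemma uniq_flattenP (T U : eqType) (F : T -> seq U) (s : seq T) : uniq s ->
  uniq (flatten (map F s)) <->
  (forall x, x \in s -> uniq (F x)) /\
  (forall x y z, x \in s -> y \in s -> z \in F x -> z \in F y -> x = y).
Proof.
elim: s => //= a s IH /andP[aNs us]; rewrite cat_uniq; split.
  case/and3P=> uF /hasPn dis /(IH us)[H1 H2].
  have H z y : y \in s -> z \in F y -> z \notin F a.
    by move=> ys zy; apply: dis; apply/flatten_mapP; exists y.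
  split=> [x|x y z]; rewrite !inE; first by case/orP=> [/eqP->|/H1].
  case/predU1P=> [->|xs]; case/predU1P=> [->|ys] //; last exact: H2.
    by move=> za zy; have := H z y ys zy; rewrite za.
  by move=> zx za; have := H z x xs zx; rewrite za.
case=> H1 H2; rewrite H1 ?mem_head //=; apply/andP; split.
  apply/hasPn => z /flatten_mapP[y ys zy]; apply: contraNN aNs => za.
  by rewrite (H2 a y z) ?mem_head // inE ys orbT.
apply/(IH us); split=> [x xs|x y z xs ys]; first by apply: H1; rewrite inE xs orbT.
by apply: H2; rewrite inE ?xs ?ys orbT.
Qed.

Lemma clean_sigma S : clean (sigma S) = uniq (flatten (map (sa S) (so S))).
Proof.
rewrite /clean /sigma /sigma_on -map_comp; congr (uniq (flatten _)).
by apply/eq_map => K /=; rewrite names_ctxt.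
Qed.

Lemma R_raw_rcons P K G : R_raw (rcons P (K, G)) =
  let C := R_raw P in
  Cat (K :: obs C) (names G ++ ars C)
    (fun x => if x \in names G then K else dom C x)
    (fun x => if x \in names G then (ctx_lookup G x).1 else cod C x)
    (fun g f => if f \in names G then
        MArr (interp (ctx_lookup G f).2 (sig_lookup P (ctx_lookup G f).1) g)
      else Defs.comp C g f).
Proof. by rewrite /R_raw rev_rcons /= revK. Qed.

(** [R_rev] adds the newest object in front, whence the reversed lists. Cleanliness guarantees that
    looking a name up in the newest context never captures an arrow of an older object. *)
Lemma R_sigma_on S o o' : valid S -> clean (sigma S) -> so S = o ++ o' ->
  let C := R_raw (sigma_on S o) in
  [/\ obs C = rev o, ars C = flatten (map (sa S) (rev o)) &
   forall K f, K \in o -> f \in sa S K -> [/\ dom C f = K, cod C f = sh S K f &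
     forall g, g \in sa S (sh S K f) -> Defs.comp C g f = MArr (sc S K f g)]].
Proof.
move=> vS; rewrite clean_sigma => /(uniq_flattenP _ (uniq_so vS))[_ dis].
elim/last_ind: o o' => [|o A IH] o' //; rewrite cat_rcons => eo.
have [IH1 IH2 IH3] := IH _ eo; rewrite /sigma_on map_rcons R_raw_rcons -/(sigma_on S o) /=.
rewrite rev_rcons IH1 IH2 names_ctxt; split=> // K f; rewrite mem_rcons inE.
have Ao : A \in so S by rewrite eo mem_cat mem_head orbT.
have := uniq_so vS; rewrite {1}eo cat_uniq => /and3P[_ /hasPn/(_ A (mem_head _ _))/= ANo _].
case/predU1P=> [->|Ko] fK.
  rewrite fK ctx_lookup_map_ent //=; split=> // g gK.
  have Yo : sh S A f \in o.
    by have := sh_lt vS Ao fK; have := uniq_so vS; rewrite eo; apply: mem_prefix.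
  by rewrite sig_lookup_sigma_on // interp_graph gK.
suff /negPf-> : f \notin sa S A by apply: IH3.
by apply: contraNN ANo => fA; rewrite -(dis K A f) // eo mem_cat Ko.
Qed.

Lemma R_presents S : valid S -> clean (sigma S) -> presents (R_raw (sigma S)) S.
Proof.
move=> vS cS; have [eo ea H] := R_sigma_on vS cS (esym (cats0 _)).
have memars f : (f \in ars (R_raw (sigma S))) = (f \in flatten (map (sa S) (so S))).
  rewrite ea map_rev.
  by apply/flattenP/flattenP => -[s]; rewrite ?mem_rev => ss fs; exists s; rewrite ?mem_rev.
have H' f : f \in ars (R_raw (sigma S)) ->
    exists K, [/\ K \in so S, f \in sa S K & dom (R_raw (sigma S)) f = K].
  rewrite memars => /flatten_mapP[K Ko fK]; exists K; split=> //.
  by have [] := H K f Ko fK.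
split.
- by rewrite eo perm_rev.
- rewrite ea map_rev; rewrite clean_sigma in cS.
  by rewrite (perm_uniq (perm_flatten (_ : perm_eq _ (map (sa S) (so S))))) // perm_rev.
- by move=> f /H'[K [Ko _ ->]].
- move=> K f Ko; apply/idP/andP => [fK|[/H'[L [Lo fL ->]] /eqP <- //]].
  have [-> _ _] := H K f Ko fK; split=> //.
  by rewrite memars; apply/flatten_mapP; exists K.
- by move=> f /H'[K [Ko fK ->]]; have [] := H K f Ko fK.
- move=> f g /H'[K [Ko fK e]] /H'[L [Lo gL e']]; rewrite e e'.
  have [_ -> Hc] := H K f Ko fK => eL; apply: Hc.
  by rewrite eL.
Qed.

(** The default of [mor_var] is never met on composable arrows of a finite inverse category, by
    [fic_comp]. *)
Definition str_of (C : fcat) (oo : seq nat) (ao : nat -> seq nat) : str :=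
  Str oo ao (fun=> cod C) (fun _ f p => mor_var (Defs.comp C p f)).

Lemma S_rawE C oo ao : S_raw C oo ao = sigma (str_of C oo ao).
Proof. by []. Qed.

(** If [g] after [f] were an identity, then [f] after [g] would be an endomorphism, hence an
    identity; skeletality would then make [f] an endomorphism, which is excluded. *)
Lemma fic_comp C f g : is_fic C -> f \in ars C -> g \in ars C -> cod C f = dom C g ->
  exists h, [/\ Defs.comp C g f = MArr h, h \in ars C, dom C h = dom C f & cod C h = cod C g].
Proof.
move=> [_ [_ [_ [Hc [_ [Hd Hs]]]]]] fC gC e.
have := Hc f g fC gC e; case E: (Defs.comp C g f) => [K|h]; last by case=> *; exists h.
case=> eK eK'; have e' : cod C g = dom C f by rewrite -eK'.
have := Hc g f gC fC e'; case E': (Defs.comp C f g) => [L|h].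
  case=> eL _; case: (Hd f fC); apply: (Hs f g) => //; first by rewrite E eK.
  by rewrite E' eL.
by case=> hC dh ch; case: (Hd h hC); rewrite dh ch.
Qed.

Lemma str_of_presents C oo ao : is_fic C -> valid_ord C oo ao -> presents C (str_of C oo ao).
Proof.
move=> ficC [po _ pa _]; have [_ [uC [dC _]]] := ficC.
split=> //=.
- by rewrite perm_sym.
- by move=> f /dC[]; rewrite (perm_mem po).
- by move=> K f; rewrite (perm_mem po) => /pa/perm_mem->; rewrite mem_filter andbC.
- by move=> f g fC gC e; have [h [-> _ _ _]] := fic_comp ficC fC gC e.
Qed.

Lemma str_of_valid C oo ao : is_fic C -> valid_ord C oo ao -> valid (str_of C oo ao).
Proof.
move=> ficC vo; have p := str_of_presents ficC vo.
case: (vo) => po Ho pa Ha; have [uo [uC [dC [_ [HA _]]]]] := ficC.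
have sub K f : K \in oo -> f \in ao K -> f \in ars C /\ dom C f = K.
  exact: (presents_ars p).
have mema K f : K \in oo -> f \in ars C -> dom C f = K -> f \in ao K.
  by move=> Ko fC e; have := presents_mem p fC; rewrite /= e.
have cmp K f y : K \in oo -> f \in ao K -> y \in ao (cod C f) ->
    [/\ f \in ars C, y \in ars C, cod C f = dom C y &
     let h := mor_var (Defs.comp C y f) in [/\ Defs.comp C y f = MArr h, h \in ars C,
       dom C h = K & cod C h = cod C y]].
  move=> Ko fK yK; have [fC df] := sub _ _ Ko fK.
  have Yo : cod C f \in oo by rewrite (perm_mem po); have [] := dC f fC.
  have [yC dy] := sub _ _ Yo yK; split=> //.
  have [h [-> hC dh ch]] := fic_comp ficC fC yC (esym dy).
  by rewrite /= -df.
split=> /=.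
- by rewrite (perm_uniq po).
- by move=> K; rewrite (perm_mem po) => /pa/perm_uniq->; rewrite filter_uniq.
- by move=> K f Ko fK; have [fC _] := sub _ _ Ko fK; rewrite (perm_mem po); have [] := dC f fC.
- by move=> K f Ko fK; have [fC <-] := sub _ _ Ko fK; apply: Ho.
- by move=> K f y Ko fK yK; have [_ _ _ [_ hC dh _]] := cmp _ _ _ Ko fK yK; apply: mema.
- move=> K f y Ko fK yK; have [fC yC e [eh _ _ _]] := cmp _ _ _ Ko fK yK.
  by apply: Ha eh => //; rewrite -(perm_mem po).
- by move=> K f y Ko fK yK; have [_ _ _ [_ _ _ ->]] := cmp _ _ _ Ko fK yK.
- move=> K f y z Ko fK yK zY; have [fC yC e [eh hC dh ch]] := cmp _ _ _ Ko fK yK.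
  have Yo : cod C f \in oo by rewrite (perm_mem po); have [] := dC f fC.
  have [_ zC e' [eh' hC' _ _]] := cmp _ _ _ Yo yK zY.
  by have := HA f y z fC yC zC e e'; rewrite /= eh eh' /= => ->.
Qed.

(** * Existence of compatible orders *)

Lemma ltn_count (T : eqType) (a b : pred T) (s : seq T) x :
  subpred a b -> x \in s -> b x -> ~~ a x -> count a s < count b s.
Proof.
move=> ab + bx nax; elim: s => //= z s IH; rewrite inE => /predU1P[<-|/IH lt].
  by rewrite bx (negPf nax) ltnS sub_count.
have leab : a z <= b z by case az: (a z) => //; rewrite ab.
by rewrite -addnS leq_add.
Qed.

(** The number of objects reached from [K] by a non-identity arrow. It drops along every arrow [f]:
    what the codomain reaches is reached from the domain by composition, and the codomain is reached
    by [f] but not by itself. *)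
Definition rank (C : fcat) (K : nat) : nat :=
  count (fun L => has (fun f => (dom C f == K) && (cod C f == L)) (ars C)) (obs C).

Lemma rank_lt C f : is_fic C -> f \in ars C -> rank C (cod C f) < rank C (dom C f).
Proof.
move=> ficC fC; have [_ [_ [dC [_ [_ [Hd _]]]]]] := ficC.
apply: (@ltn_count _ _ _ _ (cod C f)).
- move=> L /hasP[g gC /andP[/eqP dg /eqP cg]].
  have [h [_ hC dh ch]] := fic_comp ficC fC gC (esym dg).
  by apply/hasP; exists h => //; rewrite dh ch cg !eqxx.
- by have [] := dC f fC.
- by apply/hasP; exists f; rewrite ?eqxx.
- by apply/hasP => -[g gC /andP[/eqP dg /eqP cg]]; apply: (Hd g gC); rewrite dg cg.
Qed.

Lemma index_sort_lt (r : nat -> nat) (s : seq nat) x y : x \in s -> y \in s -> r x < r y ->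
  index x (sort (relpre r leq) s) < index y (sort (relpre r leq) s).
Proof.
move=> xs ys; rewrite !ltnNge; apply: contraNN => le.
have tr : transitive (relpre r leq) by move=> b a c /=; apply: leq_trans.
have re : reflexive (relpre r leq) by move=> a /=.
have sS : sorted (relpre r leq) (sort (relpre r leq) s).
  by apply: sort_sorted => a b /=; apply: leq_total.
by apply: (sorted_leq_index tr re sS _ _ _ _ le); rewrite mem_sort.
Qed.

Lemma valid_ord_exists C : is_fic C -> exists oo ao, valid_ord C oo ao.
Proof.
move=> ficC; have [_ [_ [dC _]]] := ficC.
exists (sort (relpre (rank C) leq) (obs C)).
(* Arrows are sorted by the rank of their codomain: composing [f] with [g] moves the codomain along
   [g], to strictly smaller rank. *)
exists (fun K => sort (relpre (fun f => rank C (cod C f)) leq) [seq f <- ars C | dom C f == K]).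
split.
- by rewrite perm_sort.
- by move=> f fC; have [? ?] := dC f fC; apply: index_sort_lt => //; apply: rank_lt.
- by move=> K _; rewrite perm_sort.
- move=> K f g h Ko; rewrite mem_sort mem_filter => /andP[/eqP df fC] gC e eh.
  have [h' [eh' hC dh ch]] := fic_comp ficC fC gC e.
  have hh : h' = h by move: eh; rewrite eh' => -[].
  rewrite {}hh in hC dh ch.
  apply: (index_sort_lt (r := fun f => rank C (cod C f))).
  + by rewrite mem_filter hC dh df eqxx.
  + by rewrite mem_filter fC df eqxx.
  + by rewrite ch e rank_lt.
Qed.

Lemma clean_exists P : sig_wf P -> exists P', [/\ sig_wf P', clean P' & sig_iso P P'].
Proof.
(* Encoding the pair of source and variable as one number makes the variables of different contexts
   distinct. *)
move=> /wf_sigma[S vS ->]; pose ga (K x : nat) := pickle (K, x).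
have pI : injective (@pickle (nat * nat)%type) := pcan_inj pickleK.
have gaI K : injective (ga K) by move=> x y /pI[].
have foI : {in so S &, injective id} by [].
have gaI' K : K \in so S -> {in sa S K &, injective (ga K)} by move=> _ ? ? _ _ /gaI.
have vT := valid_transport vS foI gaI'.
exists (sigma (transport id ga S)); split; first exact: sigma_wf.
  rewrite clean_sigma; apply/(uniq_flattenP _ (uniq_so vT)); split=> [K Ko|].
    exact: uniq_sa.
  move=> _ _ z /mapP[K Ko ->] /mapP[L Lo ->]; rewrite !transport_sa //.
  by move=> /mapP[x _ ->] /mapP[y _ /pI[]].
apply: rst_step; apply: step_alpha; rewrite sigma_transport //.
by apply: alpha_rename_sig => // x y.
Qed.

Theorem mainTheorem1 :
  (* R : Sig -> FIC is well defined *)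
  (forall P : Sig, sig_wf P ->
     exists P' : Sig, [/\ sig_wf P', clean P' & sig_iso P P']) /\
  (forall P : Sig, sig_wf P -> clean P -> is_fic (R_raw P)) /\
  (forall P P' : Sig, sig_wf P -> sig_wf P' -> clean P -> clean P' ->
     sig_iso P P' -> cat_iso (R_raw P) (R_raw P')) /\
  (* S : FIC -> Sig is well defined *)
  (forall C : fcat, is_fic C -> exists oo ao, valid_ord C oo ao) /\
  (forall (C : fcat) oo ao, is_fic C -> valid_ord C oo ao ->
     sig_wf (S_raw C oo ao)) /\
  (forall (C D : fcat) ooC aoC ooD aoD, is_fic C -> is_fic D ->
     valid_ord C ooC aoC -> valid_ord D ooD aoD -> cat_iso C D ->
     sig_iso (S_raw C ooC aoC) (S_raw D ooD aoD)) /\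
  (* R o S = id on FIC *)
  (forall (C : fcat) oo ao (P' : Sig), is_fic C -> valid_ord C oo ao ->
     sig_wf P' -> clean P' -> sig_iso (S_raw C oo ao) P' ->
     cat_iso (R_raw P') C) /\
  (* S o R = id on Sig *)
  (forall (P : Sig) oo ao, sig_wf P -> clean P ->
     valid_ord (R_raw P) oo ao -> sig_iso (S_raw (R_raw P) oo ao) P).
Proof.
split; first exact: clean_exists.
split.
  by move=> _ /wf_sigma[S vS ->] cS; apply: presents_fic (R_presents vS cS) vS.
split.
  move=> _ P' /wf_sigma[S vS ->] _ cS cP' /sig_iso_sigma[/(_ S vS erefl)[S' [vS' eP' s]] _].
  rewrite {}eP' in cP' *.
  exact: similar_cat_iso (R_presents vS cS) (R_presents vS' cP') vS s.
split; first exact: valid_ord_exists.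
split; first by move=> C oo ao ficC vo; rewrite S_rawE; apply: sigma_wf; apply: str_of_valid.
split.
  move=> C D ooC aoC ooD aoD fC fD vC vD iso; rewrite !S_rawE.
  apply: similar_sig_iso; [exact: str_of_valid|exact: str_of_valid|].
  by apply: cat_iso_similar iso; try exact: str_of_presents; apply: str_of_valid.
split.
  move=> C oo ao _ ficC vo /wf_sigma[S' vS' ->] cS' /sig_iso_sigma[_ /(_ S' vS' erefl)].
  (* Pulling [S'] back along the congruence gives some [S] with the same signature as
     [str_of C oo ao]; equal signatures give similar structures, which links [S'] to [C]. *)
  move=> [S [vS e s]].
  apply: (similar_cat_iso (R_presents vS' cS') (str_of_presents ficC vo) vS').
  by apply: (similar_trans vS' s); apply: sigma_eq_similar.
move=> _ oo ao /wf_sigma[S vS ->] cS vo; have p := R_presents vS cS.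
have ficR := presents_fic p vS; have vR := str_of_valid ficR vo; rewrite S_rawE.
apply: similar_sig_iso => //.
(* [str_of] and [S] both present the category [R_raw (sigma S)], so its identity isomorphism makes
   them similar. *)
exact: cat_iso_similar (str_of_presents ficR vo) p vR vS (cat_iso_refl _).
Qed.
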